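(* Let $\Gamma$ be a $\Phi_d$-complex with an associated invariant simplex $\sigma=\{v_0,v_1,\ldots,v_d\}$, and let $K$ be a pure $d$-dimensional simplicial complex. Then for $k$ odd, \[ Hom(\Gamma,K)\text{ is $k$-connected}\ \Longrightarrow\ \chi(K)\geq k+d+3 . \]
   Context: All simplicial complexes are finite. A space is $k$-connected ($k\ge -1$) if it is non-empty and its homotopy groups $\pi_i$ vanish for $0\le i\le k$. $V(K)$ is the vertex set of $K$, $\Delta^S$ is the simplex with vertex set $S$, and $[m]=\{1,\ldots,m\}$. A simplicial map is non-degenerate if it is injective on simplices. The chromatic number $\chi(K)$ is the minimum $m$ for which there is a non-degenerate simplicial map $K\to\Delta^{[m]}$. For finite simplicial complexes $K,L$, the cell complex $Hom(K,L)\subset\prod_{v\in V(K)}\Delta^{V(L)}$ is the union of the cells $c_\eta=\prod_{v\in V(K)}\Delta^{\eta(v)}$ indexed by functions $\eta:V(K)\to 2^{V(L)}\setminus\{\emptyset\}$ such that (1) $\eta(u)\cap\eta(v)=\emptyset$ whenever $u\ne v$ and $\{u,v\}\in K$; (2) for each simplex $\sigma\in K$, the join $\ast_{v\in V(\sigma)}\eta(v)$ of the $0$-dimensional complexes $\eta(v)$ is a subcomplex of $L$, i.e. every set obtained by choosing one element from each $\eta(v)$, $v\in V(\sigma)$, is a simplex of $L$. For a pure $d$-dimensional simplicial complex $\Gamma$ and a $d$-simplex $\sigma$ of $\Gamma$, the group of projectivities $\Pi(\Gamma,\sigma)$ is the group of all permutations of the vertices of $\sigma$ of the form $\overrightarrow{\sigma_0\sigma_1}\ast\cdots\ast\overrightarrow{\sigma_{n-1}\sigma_n}$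 (apply the first map first), where $\sigma_0=\sigma_n=\sigma$, each $\sigma_i$ is a $d$-simplex of $\Gamma$, consecutive simplices $\sigma_i,\sigma_{i+1}$ share a common $(d-1)$-face, and $\overrightarrow{\sigma_i\sigma_{i+1}}:\sigma_i\to\sigma_{i+1}$ is the bijection of vertex sets fixing that common face pointwise. A pure $d$-dimensional simplicial complex $\Gamma$ is a $\Phi_d$-complex if it is equipped with a simplicial involution $\omega:\Gamma\to\Gamma$ (is a $\mathbb{Z}_2$-complex) and has an $\omega$-invariant $d$-simplex $\sigma=\{v_0,\ldots,v_d\}$ such that the restriction $\tau:=\omega|_\sigma$ is a non-trivial element of the group $\Pi(\Gamma,\sigma)$. *)

(* Defs.v *)
From HB Require Import structures.
From mathcomp Require Import all_boot all_order all_algebra all_fingroup.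
From mathcomp Require Import all_classical all_reals all_analysis.

Set Implicit Arguments.
Unset Strict Implicit.
Unset Printing Implicit Defensive.

Import Order.TTheory GRing.Theory Num.Theory.
Import numFieldNormedType.Exports.

Local Open Scope classical_set_scope.
Local Open Scope ring_scope.

(* Simplices are non-empty and [V] is exactly the vertex set (faces1), so     *)
(* that V(K) is a type; a d-simplex is a face with d.+1 elements.             *)
Record scomplex (V : finType) := SComplex {
  faces :> {set {set V}};
  faces_neq0 : finset.set0 \notin faces;
  faces_sub : forall s t : {set V},
    s \in faces -> t \subset s -> t != finset.set0 -> t \in faces;
  faces1 : forall v : V, finset.set1 v \in faces }.

Section FullSimplex.
Variable S : finType.

Definition simplex_faces : {set {set S}} := [set s : {set S} | s != finset.set0]%SET.

Lemma simplex_faces_neq0 : finset.set0 \notin simplex_faces.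
Proof. by rewrite inE eqxx. Qed.

Lemma simplex_faces_sub (s t : {set S}) :
  s \in simplex_faces -> t \subset s -> t != finset.set0 -> t \in simplex_faces.
Proof. by rewrite !inE. Qed.

Lemma simplex_faces1 (v : S) : finset.set1 v \in simplex_faces.
Proof. by rewrite inE; apply/finset.set0Pn; exists v; rewrite inE. Qed.

Definition full_simplex : scomplex S :=
  SComplex simplex_faces_neq0 simplex_faces_sub simplex_faces1.

End FullSimplex.

Definition simplicial (V W : finType) (K : scomplex V) (L : scomplex W)
    (f : V -> W) : Prop :=
  forall s : {set V}, s \in K -> (f @: s)%SET \in L.

Definition nondegenerate (V W : finType) (K : scomplex V) (L : scomplex W)
    (f : V -> W) : Prop :=
  simplicial K L f /\ forall s : {set V}, s \in K -> {in s &, injective f}.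

Definition colorable (V : finType) (K : scomplex V) (m : nat) : Prop :=
  exists f : V -> 'I_m, nondegenerate K (full_simplex 'I_m) f.

Lemma colorable_ex (V : finType) (K : scomplex V) :
  exists m, `[< colorable K m >].
Proof.
exists #|V|; apply/asboolP; exists enum_rank; split=> s sK; last first.
  by move=> x y _ _; apply: enum_rank_inj.
rewrite inE; have : s != finset.set0.
  by apply: contraNneq (faces_neq0 K) => <-.
case/finset.set0Pn=> x xs; apply/finset.set0Pn.
by exists (enum_rank x); apply: imset_f.
Qed.

Definition chromatic (V : finType) (K : scomplex V) : nat :=
  ex_minn (colorable_ex K).

Definition pure (V : finType) (K : scomplex V) (d : nat) : Prop :=
  (exists s : {set V}, s \in K) /\
  forall s : {set V}, s \in K ->
    exists t : {set V}, [/\ t \in K, s \subset t & #|t| = d.+1].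

Section Projectivities.
Variables (V : finType) (G : scomplex V) (d : nat).

(* Two d-simplices with a common (d-1)-face; for d = 0 this is the empty     *)
(* face. Consecutive simplices of a chain may coincide.                       *)
Definition ridge_adjacent (s t : {set V}) : bool :=
  [&& s \in G, t \in G, #|s| == d.+1, #|t| == d.+1 & (d <= #|s :&: t|)%N].

(* For s and t adjacent: fix s :&: t and send the vertex of s :\: t, if any,  *)
(* to that of t :\: s.                                                        *)
Definition perspectivity (s t : {set V}) (v : V) : V :=
  if v \in t then v else odflt v [pick w in (t :\: s)%SET].

Fixpoint transport (s : {set V}) (c : seq {set V}) (v : V) : V :=
  if c is t :: c' then transport t c' (perspectivity s t v) else v.

(* Permutations of sigma are the permutations of V with support in sigma.     *)
Definition projectivity (sigma : {set V}) (g : {perm V}) : Prop :=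
  perm_on sigma g /\
  exists c : seq {set V}, [/\ path ridge_adjacent sigma c, last sigma c = sigma &
    {in sigma, forall v, g v = transport sigma c v}].

Definition projectivities (sigma : {set V}) : {set {perm V}} :=
  [set g : {perm V} | `[< projectivity sigma g >]]%SET.

Lemma transport_cat s c1 c2 v :
  transport s (c1 ++ c2) v = transport (last s c1) c2 (transport s c1 v).
Proof. by elim: c1 s v => //= t c1 IH s v. Qed.

Lemma projectivities_group sigma : group_set (projectivities sigma).
Proof.
apply/group_setP; split.
  rewrite inE; apply/asboolP; split; first exact: perm_on1.
  by exists [::]; split=> // v _; rewrite perm1.
move=> g h; rewrite !inE => -[gs [c1 [p1 l1 e1]]] [hs [c2 [p2 l2 e2]]]; split.
  exact: perm_onM.
exists (c1 ++ c2); split; first by rewrite cat_path p1 l1 p2.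
  by rewrite last_cat l1.
move=> v vs; rewrite transport_cat l1 permM -e1 // e2 //.
by rewrite (perm_closed _ gs).
Qed.

Canonical projectivity_group sigma := Group (projectivities_group sigma).

Record Phi_complex (omega : {perm V}) (sigma : {set V}) : Prop := {
  Phi_pure : pure G d;
  Phi_involutive : involutive omega;
  Phi_simplicial : simplicial G G omega;
  Phi_sigma_in : sigma \in G;
  Phi_sigma_dim : #|sigma| = d.+1;
  Phi_sigma_inv : (omega @: sigma)%SET = sigma;
  Phi_projectivity : restr_perm sigma omega \in projectivity_group sigma;
  Phi_nontrivial : restr_perm sigma omega != 1%g }.

End Projectivities.

Section HomComplex.
Variables (R : realType) (V W : finType) (K : scomplex V) (L : scomplex W).

Definition hom_index (eta : V -> {set W}) : Prop :=
  [/\ forall v, eta v != finset.set0,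
      forall u v, u != v -> [set u; v]%SET \in K ->
        eta u :&: eta v = finset.set0 &
      forall s : {set V}, s \in K -> forall f : V -> W,
        {in s, forall v, f v \in eta v} -> (f @: s)%SET \in L].

(* The simplex with vertex set S, in barycentric coordinates, as a face of    *)
(* the simplex with vertex set W.                                             *)
Definition geom_simplex (S : {set W}) : set {ptws W -> R} :=
  [set x | [/\ forall w, 0 <= x w, \sum_(w : W) x w = 1 &
               forall w, w \notin S -> x w = 0]].

Definition hom_cell (eta : V -> {set W}) : set {ptws V -> {ptws W -> R}} :=
  [set x | forall v, geom_simplex (eta v) (x v)].

Definition hom_points : set {ptws V -> {ptws W -> R}} :=
  \bigcup_(eta in [set eta | hom_index eta]) hom_cell eta.

Definition hom_complex : topologicalType := set_type hom_points.

End HomComplex.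

Arguments hom_complex R {V W} K L.

Section Connectivity.
Variables (R : realType) (X : topologicalType).

Definition cube n : set 'rV[R]_n := [set s | forall i, 0 <= s ord0 i <= 1].

Definition cube_boundary n : set 'rV[R]_n :=
  [set s | cube s /\ exists i, s ord0 i = 0 \/ s ord0 i = 1].

(* Representatives of the elements of pi_n(X, x0). They are total functions   *)
(* of which only the values on the cube matter.                               *)
Definition spheroid n (x0 : X) (f : 'rV[R]_n -> X) : Prop :=
  {within @cube n, continuous f} /\
  forall s, cube_boundary s -> f s = x0.

Definition homotopic_rel n (x0 : X) (f g : 'rV[R]_n -> X) : Prop :=
  exists H : 'rV[R]_n * R -> X,
    [/\ {within @cube n `*` `[0, 1], continuous H},
        forall s, cube s -> H (s, 0) = f s,
        forall s, cube s -> H (s, 1) = g s &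
        forall s (t : R), cube_boundary s -> 0 <= t <= 1 -> H (s, t) = x0].

(* pi_n(X, x0) has a single element; for n = 0 the boundary of the cube is    *)
(* empty and this says that X is path-connected.                              *)
Definition pi_vanishes n (x0 : X) : Prop :=
  forall f g : 'rV[R]_n -> X, spheroid x0 f -> spheroid x0 g ->
    homotopic_rel x0 f g.

Definition k_connected (k : int) : Prop :=
  [set: X] !=set0 /\
  forall (i : nat), i%:Z <= k -> forall x0 : X, pi_vanishes i x0.

End Connectivity.

(* Main.v *)
(* Suppose that K has a colouring with q <= n + d + 1 colours, where n = k + 1 *)

(* The contradiction is a single count. Let x and y be the signed numbers of simplices whose labels
   alternate starting with [true], resp. [false], on one hemisphere [e] of an equivariant n-sphere
   in the Hom complex. [equivariant_sphere] builds [e] one dimension at a time, passing through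
   vanishing homotopy groups by [extend_antipodal], and [degree_fan] keeps x + y odd on the way.

   The other hemisphere is [T] after [e]. As [T] turns labels into their opposites, the counts there
   are y and x, and as n is even the whole sphere has degree x - y. This difference is a homotopy
   invariant by [degree_homotopy]. Hence it survives when the tuple is read at the vertices of an
   adjacent simplex of Gamma ([stage_degree_link]), and so along the chain of the projectivity
   ([stage_degree_path]). At the end of the chain the tuple of a point is that of its image under
   [T], so the difference has become y - x. Thus x = y, and x + y is even.

   The labels can be used for three reasons. Disjoint supports among q colours bound the axis by n
   ([card_cell]), so no n+2 labels alternate. Close points never have opposite labels
   ([position_label_near]), and exchanging two vertices flips the sign ([position_label_swap]).
   Supports stay disjoint while a vertex moves by [perspectivity_edges], [color_disjoint] and
   [interpolate_position]. *)
(* is even. It sends Hom(Gamma, K) to tuples of points of a (q-1)-simplex     *)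
(* indexed by the vertices of sigma, with pairwise disjoint supports, and a   *)
(* cell (A_v) of the space of such tuples carries a label: the axis           *)
(* sum (|A_v| - 1) <= n and the sign of min A_b - min A_a, where omega        *)
(* exchanges a and b. These labels give a map to the n-dimensional            *)
(* cross-polytope which omega turns into its antipode. Connectivity gives an  *)
(* equivariant map S^n -> Hom(Gamma, K), and by Ky Fan's argument the number  *)
(* of its top simplices with alternating labels is odd. On the other hand the *)
(* projectivity moves one vertex at a time, along straight segments which     *)
(* keep the supports disjoint, so it gives a homotopy from the map S^n ->     *)
(* (tuples) to its composite with omega. As n is even, the antipode of S^n    *)
(* has degree -1, so the signed numbers of positively and of negatively       *)
(* alternating simplices coming from a hemisphere agree, and their sum is     *)
(* even. Degrees are computed with simplicial cochains on fine grids.         *)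
Require Import Defs.
From mathcomp Require Import all_boot all_order all_algebra all_fingroup.
From mathcomp Require Import all_classical all_reals all_analysis.
From mathcomp Require Import zify ring lra.

Set Implicit Arguments.
Unset Strict Implicit.
Unset Printing Implicit Defensive.

Import Order.TTheory GRing.Theory Num.Theory.
Import numFieldNormedType.Exports.

Local Open Scope ring_scope.

(** * Cochains on sequences and the triangulated grid *)

Section Cochains.
Variable T : eqType.
Implicit Types (c d : T -> int) (f g : seq T -> int) (l u : seq T).

(** The exterior product of the 1-form [c] with the cochain [f], expanded along the entry given to
    [c]. *)
Fixpoint wedge c f l : int :=
  if l is x :: l' then c x * f l' - wedge c (fun u => f (x :: u)) l' else 0.

Definition coboundary := wedge (fun=> 1).

Lemma eq_wedge c f g l :
  (forall u, subseq u l -> (size u).+1 = size l -> f u = g u) ->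
  wedge c f l = wedge c g l.
Proof.
elim: l f g => // x l IH f g fg; rewrite /= fg ?subseq_cons //.
rewrite (IH _ (fun u => g (x :: u))) // => u ul su; apply: fg.
  by rewrite /= eqxx.
by rewrite /= su.
Qed.

Lemma eq_wedgel c d f l : {in l, c =1 d} -> wedge c f l = wedge d f l.
Proof.
elim: l f => //= x l IH f cd; rewrite cd ?mem_head // IH // => y yl.
by rewrite cd // inE yl orbT.
Qed.

Lemma wedgeDl c d f l : wedge (fun x => c x + d x) f l = wedge c f l + wedge d f l.
Proof. by elim: l f => [|x l IH] f /=; rewrite ?addr0 // IH; ring. Qed.

Lemma wedgeDr c f g l : wedge c (fun u => f u + g u) l = wedge c f l + wedge c g l.
Proof. by elim: l f g => [|x l IH] f g /=; rewrite ?addr0 // IH; ring. Qed.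

Lemma wedgeMr c (a : int) f l : wedge c (fun u => a * f u) l = a * wedge c f l.
Proof. by elim: l f => [|x l IH] f /=; rewrite ?mulr0 // IH; ring. Qed.

Lemma wedgeNr c f l : wedge c (fun u => - f u) l = - wedge c f l.
Proof.
rewrite -mulN1r -wedgeMr; apply: eq_wedge => u _ _; by rewrite mulN1r.
Qed.

Lemma wedgeBr c f g l : wedge c (fun u => f u - g u) l = wedge c f l - wedge c g l.
Proof. by rewrite wedgeDr wedgeNr. Qed.

Lemma wedge_size c f l :
  wedge c (fun u => (-1) ^+ size u * f u) l = - (-1) ^+ size l * wedge c f l.
Proof.
elim: l f => [|x l IH] f /=; first by rewrite mulr0.
have -> : wedge c (fun u => (-1) ^+ (size u).+1 * f (x :: u)) l =
          wedge c (fun u => (-1) * ((-1) ^+ size u * f (x :: u))) l.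
  by apply: eq_wedge => u _ _; rewrite exprS mulrA.
by rewrite wedgeMr IH exprS; ring.
Qed.

Lemma wedgeC c d f l : wedge c (wedge d f) l = - wedge d (wedge c f) l.
Proof.
elim: l f => [|x l IH] f /=; first by rewrite oppr0.
by rewrite !wedgeBr !wedgeMr (IH (fun u => f (x :: u))); ring.
Qed.

Lemma wedge_rcons c f l x :
  wedge c f (rcons l x) =
  wedge c (fun u => f (rcons u x)) l + (-1) ^+ size l * (c x * f l).
Proof.
elim: l f => [|y l IH] f /=; first by rewrite expr0; ring.
by rewrite IH exprS; ring.
Qed.

(** Deleting entry i of a reversed list of length m deletes entry m-1-i of the list, so all signs
    change by (-1)^(m-1). *)
Lemma wedge_rev c f l :
  wedge c (fun u => f (rev u)) l = - (-1) ^+ size l * wedge c f (rev l).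
Proof.
elim: l f => [|x l IH] f /=; first by rewrite mulr0.
have -> : wedge c (fun u => f (rev (x :: u))) l =
          wedge c (fun u => (fun v => f (rcons v x)) (rev u)) l.
  by apply: eq_wedge => u _ _; rewrite rev_cons.
rewrite (IH (fun v => f (rcons v x))) rev_cons wedge_rcons size_rev exprS.
by rewrite -signr_odd; case: (odd _); rewrite ?expr1 ?expr0; ring.
Qed.

(** The two deletions of a repeated entry cancel, and any other deletion leaves the repetition. *)
Lemma wedge_repeat c f l1 x l2 :
  (forall u1 y u2, f (u1 ++ y :: y :: u2) = 0) ->
  wedge c f (l1 ++ x :: x :: l2) = 0.
Proof.
elim: l1 f => [|y l1 IH] f f0 /=.
  rewrite opprB addrCA subrr addr0 -[RHS](mul0r (wedge c f l2)) -wedgeMr.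
  by apply: eq_wedge => u _ _; rewrite (f0 [::]) mul0r.
by rewrite f0 mulr0 IH ?subr0 // => u1 z u2; apply: (f0 (y :: u1)).
Qed.

End Cochains.

Lemma wedge_map (T U : eqType) (h : T -> U) c f l :
  wedge c f (map h l) = wedge (fun x => c (h x)) (fun u => f (map h u)) l.
Proof. by elim: l f => //= x l IH f; rewrite IH. Qed.

Section Prism.
Variables T U : eqType.
Implicit Types (i j : T -> U) (f g : seq U -> int) (l : seq T).

(** The cylinder over a simplex with bottom [i] and top [j], cut into the simplices i x_0, ..., i
    x_k, j x_k, ..., j x_m with sign (-1)^k. *)
Fixpoint prism i j f l : int :=
  if l is x :: l' then
    f (i x :: j x :: map j l') - prism i j (fun u => f (i x :: u)) l'
  else 0.

Lemma eq_prism i j f g l :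
  (forall u, size u = (size l).+1 -> {subset u <= map i l ++ map j l} ->
     f u = g u) ->
  prism i j f l = prism i j g l.
Proof.
elim: l f g => //= x l IH f g fg.
rewrite fg /= ?size_map //; last first.
  by move=> y; rewrite !(inE, mem_cat) => /or3P[] ->; rewrite ?orbT.
rewrite (IH _ (fun u => g (i x :: u))) // => u su ul; apply: fg; first by rewrite /= su.
move=> y; rewrite !(inE, mem_cat) => /orP[->//|/ul].
by rewrite mem_cat => /orP[] ->; rewrite ?orbT.
Qed.

Lemma prismD i j f g l :
  prism i j (fun u => f u + g u) l = prism i j f l + prism i j g l.
Proof. by elim: l f g => [|x l IH] f g /=; rewrite ?addr0 // IH; ring. Qed.

Lemma prismM i j (a : int) f l : prism i j (fun u => a * f u) l = a * prism i j f l.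
Proof. by elim: l f => [|x l IH] f /=; rewrite ?mulr0 // IH; ring. Qed.

Lemma prismB i j f g l :
  prism i j (fun u => f u - g u) l = prism i j f l - prism i j g l.
Proof. by elim: l f g => [|x l IH] f g /=; rewrite ?subrr // IH; ring. Qed.

(** The cochain homotopy between pulling back along [i] and along [j]: inner walls of the cylinder
    cancel. *)
Lemma prism_coboundary i j f l :
  prism i j (coboundary f) l + coboundary (prism i j f) l =
  f (map j l) - f (map i l).
Proof.
elim: l f => [|x l IH] f; first by rewrite /= /coboundary /= addr0 subrr.
rewrite /coboundary /=.
rewrite prismB prismM (wedgeBr _ (fun u => f (i x :: j x :: map j u))) wedge_map /=.
move: (IH (fun u => f (i x :: u))); rewrite /coboundary /=.
lra.
Qed.

Lemma prism_rcons i j f l x :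
  prism i j f (rcons l x) = prism i j (fun u => f (rcons u (j x))) l +
    (-1) ^+ size l * f (rcons (rcons (map i l) (i x)) (j x)).
Proof.
elim: l f => [|y l IH] f /=; first by rewrite expr0; ring.
by rewrite IH exprS map_rcons; ring.
Qed.

(** Reversing the vertex order turns the cylinder upside down and lists its pieces backwards. *)
Lemma prism_rev i j f l :
  prism i j (fun u => f (rev u)) l = - (-1) ^+ size l * prism j i f (rev l).
Proof.
elim: l f => [|x l IH] f /=; first by rewrite mulr0.
have -> : prism i j (fun u => f (rev (i x :: u))) l =
          prism i j (fun u => (fun v => f (rcons v (i x))) (rev u)) l.
  by apply: eq_prism => u _ _; rewrite rev_cons.
rewrite (IH (fun v => f (rcons v (i x)))) [rev (x :: l)]rev_cons prism_rcons.
rewrite size_rev exprS !rev_cons map_rev.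
by rewrite -signr_odd; case: (odd _); rewrite ?expr1 ?expr0; ring.
Qed.

End Prism.

Lemma prism_map (T U T' U' : eqType) (i j : T -> U) (i' j' : T' -> U')
    (h : T -> T') (k : U -> U') f l :
  {in l, forall x, k (i x) = i' (h x)} -> {in l, forall x, k (j x) = j' (h x)} ->
  prism i j (fun u => f (map k u)) l = prism i' j' f (map h l).
Proof.
elim: l f => //= x l IH f hi hj; rewrite hi ?hj ?mem_head //.
have -> : map k (map j l) = map j' (map h l).
  rewrite -!map_comp; apply/eq_in_map => y yl /=.
  by rewrite hj // inE yl orbT.
have hi' : {in l, forall y, k (i y) = i' (h y)} by move=> y yl; rewrite hi // inE yl orbT.
have hj' : {in l, forall y, k (j y) = j' (h y)} by move=> y yl; rewrite hj // inE yl orbT.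
by rewrite -(IH (fun u => f (i' (h x) :: u)) hi' hj').
Qed.

(** * Summation over the Kuhn triangulation of a cube *)

Section Box.
Variable N : nat.
Implicit Types (n : nat) (f g : seq (seq nat) -> int) (l : seq (seq nat)).

Definition slab f l : int := \sum_(t < N) prism (cons (t : nat)) (cons t.+1) f l.

(* The sum of [f] over the n-simplices of the Kuhn triangulation of [0, N]^n, *)
(* obtained by iterating the prism operator.                                  *)
Fixpoint box n f : int := if n is n'.+1 then box n' (slab f) else f [:: [::]].

Definition grid n (p : seq nat) := (size p == n) && all (fun x => x <= N)%N p.

Definition in_cube n l := all (grid n) l /\
  exists b : seq nat, forall p i, p \in l -> (i < n)%N ->
    (nth 0 b i <= nth 0 p i <= (nth 0 b i).+1)%N.

Definition on_face n l := exists2 i, (i < n)%N &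
  (forall p, p \in l -> nth 0%N p i = 0%N) \/ (forall p, p \in l -> nth 0%N p i = N).

Definition boundary n (p : seq nat) :=
  grid n p && has (fun x => (x == 0) || (x == N))%N p.

Definition refl (p : seq nat) := map (fun x => N - x)%N p.

Lemma in_cube_step n l u (t : nat) : in_cube n l -> (t < N)%N ->
  {subset u <= map (cons t) l ++ map (cons t.+1) l} -> in_cube n.+1 u.
Proof.
move=> [/allP lg [b lb]] tN ul; split.
  apply/allP => p /ul; rewrite mem_cat => /orP[] /mapP[q /lg/andP[/eqP sq aq] ->];
  by rewrite /grid /= sq eqxx aq ?(ltnW tN) ?tN.
exists (t :: b) => p [|i] /ul; rewrite mem_cat => /orP[] /mapP[q ql ->] //= ni;
  rewrite ?leqnn ?leqnSn //; exact: lb.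
Qed.

Lemma on_face_step n l u t :
  {subset u <= map (cons t) l ++ map (cons t.+1) l} -> on_face n l ->
  on_face n.+1 u.
Proof.
move=> ul [i ni h]; exists i.+1 => //; case: h => h; [left|right];
by move=> p /ul; rewrite mem_cat => /orP[] /mapP[q ql ->] /=; apply: h.
Qed.

Lemma in_cube_cons n l t : (t <= N)%N -> in_cube n l -> in_cube n.+1 (map (cons t) l).
Proof.
move=> tN [/allP lg [b lb]]; split.
  by apply/allP => _ /mapP[q /lg/andP[/eqP sq aq] ->]; rewrite /grid /= sq eqxx aq tN.
exists (t :: b) => p [|i] /mapP[q ql ->] //= ni; first by rewrite leqnn leqnSn.
exact: lb.
Qed.

Lemma eq_slab n f g l : in_cube n l ->
  (forall u, in_cube n.+1 u -> size u = (size l).+1 -> f u = g u) ->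
  slab f l = slab g l.
Proof.
move=> lc fg; apply: eq_bigr => t _; apply: eq_prism => u su ul.
by apply: fg => //; apply: in_cube_step ul.
Qed.

Lemma eq_box n f g :
  (forall l, in_cube n l -> size l = n.+1 -> f l = g l) -> box n f = box n g.
Proof.
elim: n f g => [|n IH] f g fg /=.
  by apply: fg => //; split=> //; exists [::].
apply: IH => l lc sl; apply: (eq_slab lc) => u uc su; apply: fg => //.
by rewrite su sl.
Qed.

Lemma slabM (a : int) f l : slab (fun u => a * f u) l = a * slab f l.
Proof. by rewrite /slab mulr_sumr; apply: eq_bigr => t _; rewrite prismM. Qed.

Lemma slabD f g l : slab (fun u => f u + g u) l = slab f l + slab g l.
Proof. by rewrite /slab -big_split; apply: eq_bigr => t _; rewrite prismD. Qed.

Lemma boxM n (a : int) f : box n (fun u => a * f u) = a * box n f.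
Proof.
elim: n f => //= n IH f; rewrite -IH; apply: eq_box => l _ _; exact: slabM.
Qed.

Lemma boxD n f g : box n (fun u => f u + g u) = box n f + box n g.
Proof.
elim: n f g => //= n IH f g; rewrite -IH; apply: eq_box => l _ _; exact: slabD.
Qed.

Lemma boxB n f g : box n (fun u => f u - g u) = box n f - box n g.
Proof.
rewrite -[- box n g]mulN1r -boxM -boxD; apply: eq_box => l _ _; by rewrite mulN1r.
Qed.

Lemma box0 n f : (forall l, in_cube n l -> size l = n.+1 -> f l = 0) -> box n f = 0.
Proof.
by move=> f0; rewrite -(mul0r (box n f)) -boxM; apply: eq_box => l lc sl; rewrite f0 ?mul0r.
Qed.

Lemma slab_coboundary f l :
  slab (coboundary f) l + coboundary (slab f) l =
  f (map (cons N) l) - f (map (cons 0%N) l).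
Proof.
have -> : coboundary (slab f) l =
    \sum_(t < N) coboundary (prism (cons (t : nat)) (cons t.+1) f) l.
  rewrite /slab; elim: (N) => [|M IH].
    rewrite big_ord0 -[RHS](mul0r (coboundary f l)) -wedgeMr.
    by apply: eq_wedge => u _ _; rewrite big_ord0 mul0r.
  rewrite big_ord_recr -IH /= /coboundary -wedgeDr; apply: eq_wedge => u _ _.
  by rewrite big_ord_recr.
rewrite -big_split /=.
under eq_bigr => t _ do rewrite prism_coboundary.
by rewrite -(big_mkord xpredT (fun t => f (map (cons t.+1) l) - f (map (cons t) l)))
  telescope_sumr.
Qed.

(** Prism homotopies of successive layers telescope. The last term is the share of the vertical
    sides; being a coboundary, it sees only what [f] does over the boundary. *)
Lemma stokes n f :
  box n.+1 (coboundary f) = box n (fun l => f (map (cons N) l)) -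
    box n (fun l => f (map (cons 0%N) l)) - box n (coboundary (slab f)).
Proof.
rewrite /= -!boxB; apply: eq_box => l _ _.
by rewrite -slab_coboundary addrK.
Qed.

Lemma slab_nil f : slab f [::] = 0.
Proof. by rewrite /slab big1. Qed.

(** Induction with [stokes]: top and bottom contribute nothing, and [slab] again vanishes on the
    faces. *)
Lemma box_coboundary0 n f : f [::] = 0 ->
  (forall l, in_cube n l -> on_face n l -> f l = 0) ->
  box n (coboundary f) = 0.
Proof.
elim: n f => [|n IH] f f0 fb; first by rewrite /= /coboundary /= f0 mulr0 subr0.
have f0' : slab f [::] = 0 by rewrite slab_nil.
rewrite stokes (IH _ f0') ?subr0 => [|l lc lf].
  rewrite box0 => [|l lc _]; last first.
    apply: fb; first exact: in_cube_cons.
    by exists 0%N => //; right => _ /mapP[q _ ->].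
  rewrite box0 ?subrr // => l lc _; apply: fb; first exact: in_cube_cons.
  by exists 0%N => //; left => _ /mapP[q _ ->].
rewrite /slab big1 // => t _; rewrite -(mul0r (prism (cons (t : nat)) (cons t.+1) f l)) -prismM.
apply: eq_prism => u _ ul; rewrite mul0r; apply: fb; last exact: on_face_step ul lf.
exact: in_cube_step ul.
Qed.

Lemma grid_refl n p : grid n p -> grid n (refl p).
Proof.
move=> /andP[sp _]; rewrite /grid /refl size_map sp all_map.
by apply/allP => x _ /=; apply: leq_subr.
Qed.

Lemma slab_refl f l :
  slab (fun u => f (rev (map refl u))) l =
  - (-1) ^+ size l * slab f (rev (map refl l)).
Proof.
rewrite /slab [in RHS](reindex_inj rev_ord_inj) mulr_sumr; apply: eq_bigr => t _ /=.
rewrite -(size_map refl) -prism_rev.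
rewrite -(prism_map (i := cons (t : nat)) (j := cons t.+1) (k := refl)
  (i' := cons (N - t.+1).+1) (j' := cons (N - t.+1)%N)
  (h := refl) (fun u => f (rev u))) // => p _ /=.
by rewrite subnSK.
Qed.

(** Reflection in the centre preserves the triangulation but reverses the vertex order. Passing from
    dimension n to n+1 costs (-1)^n by [slab_refl], and these exponents add up to the binomial
    coefficient. *)
Lemma box_refl n f :
  box n (fun l => f (rev (map refl l))) = (-1) ^+ 'C(n, 2) * box n f.
Proof.
elim: n f => [|n IH] f /=; first by rewrite mul1r.
rewrite binS addnC bin1 exprD -mulrA -(IH (slab f)) -boxM.
apply: eq_box => l _ sl; rewrite slab_refl sl exprS; congr (_ * _); ring.
Qed.

End Box.

(** * Alternating labels and their degree *)

Definition label : Type := bool * nat.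

Definition opp_label (x : label) : label := (~~ x.1, x.2).

Definition consistent (l : seq label) := all (fun x => opp_label x \notin l) l.

Lemma consistent_subseq l u : subseq u l -> consistent l -> consistent u.
Proof.
move=> /mem_subseq ul /allP lc; apply/allP => x /ul /lc.
by apply: contra => /ul.
Qed.

(* On lists of labels of length j+1: the signed indicator of the lists which  *)
(* sort to labels with increasing axes and alternating signs, starting with   *)
(* [s]. It is the exterior form sum of the s a_0 /\ -s a_1 /\ ... /\ a_j.     *)
Fixpoint alternating (axes : seq nat) (s : bool) (l : seq label) : int :=
  if axes is a :: r then
    alternating r s l + wedge (fun x => (x == (s, a))%:R) (alternating r (~~ s)) l
  else (l == [::])%:R.

Lemma wedge_notin (T : eqType) (x : T) f (l : seq T) : x \notin l ->
  wedge (fun y => (y == x)%:R) f l = 0.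
Proof.
elim: l f => //= y l IH f; rewrite inE negb_or => /andP[xy xl].
by rewrite IH // eq_sym (negbTE xy) mul0r subrr.
Qed.

Lemma wedgeK (T : eqType) (c : T -> int) f (l : seq T) : wedge c (wedge c f) l = 0.
Proof. by have := wedgeC c c f l; lra. Qed.

(** If deleting an entry leaves an alternating list, then either two neighbours in axis order have
    equal signs, and deleting one or the other cancels, or the list itself alternates and the
    deleted label is its first, giving [~~ s], or its last, giving [s]. *)
Lemma alternating_coboundary_axes axes s l : uniq axes -> consistent l ->
  wedge (fun x => (x.2 \in axes)%:R) (alternating axes s) l =
  alternating axes (~~ s) l - (-1) ^+ size l * alternating axes s l.
Proof.
elim: axes s l => [|a r IH] s l /=.
  move=> _ _; rewrite (eq_wedgel (d := fun=> 0 * 1)) //.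
  case: l => [|x l] /=; first by rewrite mulr1 subrr.
  have w0 : forall f, wedge (fun=> 0 * 1 : int) f l = 0.
    by elim: l => //= y l IHl f; rewrite IHl !mul0r subrr.
  by rewrite w0 !mul0r mulr0 subrr.
move=> /andP[ar ur] lc.
rewrite (eq_wedgel (d := fun x => ((x == (s, a))%:R + (x == (~~ s, a))%:R) +
    (x.2 \in r)%:R)); last first.
  move=> x _; case: x => t b; rewrite inE /= !xpair_eqE; case: (b =P a) => [->|_].
    by rewrite (negbTE ar) !andbT; case: s t => [] [].
  by rewrite !andbF !add0r.
rewrite wedgeDl wedgeDl !wedgeDr wedgeK negbK IH //.
rewrite [X in _ + (_ + X)]wedgeC.
have -> : wedge (fun x => (x == (s, a))%:R)
    (wedge (fun x : label => (x.2 \in r)%:R) (alternating r (~~ s))) l =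
  wedge (fun x => (x == (s, a))%:R) (alternating r s) l +
  (-1) ^+ size l * wedge (fun x => (x == (s, a))%:R) (alternating r (~~ s)) l.
  rewrite (@eq_wedge _ _ _ (fun u => alternating r s u -
     (-1) ^+ size u * alternating r (~~ s) u)); last first.
    by move=> u ul _; rewrite IH ?negbK // (consistent_subseq ul).
  by rewrite wedgeBr wedge_size; ring.
(* A non-zero term would need both labels of axis [a] in [l], against consistency. *)
have -> : wedge (fun x => (x == (~~ s, a))%:R)
    (wedge (fun x => (x == (s, a))%:R) (alternating r (~~ s))) l = 0.
  have [sl|/wedge_notin sl] := boolP ((~~ s, a) \in l); last exact: sl.
  rewrite wedgeC wedge_notin ?oppr0 //.
  by have /allP/(_ _ sl) := lc; rewrite /opp_label /= negbK.
ring.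
Qed.

Lemma alternating_coboundary axes s l :
  uniq axes -> consistent l -> {in l, forall x, x.2 \in axes} ->
  coboundary (alternating axes s) l =
  alternating axes (~~ s) l - (-1) ^+ size l * alternating axes s l.
Proof.
move=> ua lc la; rewrite -alternating_coboundary_axes //.
by apply: eq_wedgel => x xl; rewrite la.
Qed.

(** The entries of an alternating list have distinct axes. *)
Lemma alternating_size axes s l :
  (size axes < size l)%N -> alternating axes s l = 0.
Proof.
elim: axes s l => [|a r IH] s l; first by case: l.
move=> sl /=; rewrite IH 1?ltnW // add0r.
have : forall u, (size l <= (size u).+1)%N -> alternating r (~~ s) u = 0.
  by move=> u ul; apply: IH; rewrite -ltnS (leq_trans sl ul).
move: (alternating r (~~ s)) => f; elim: l f {sl} => //= x l IHl f f0.
rewrite f0 // mulr0 IHl ?subrr // => u ul; exact: f0.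
Qed.

Lemma alternating_rev axes s l :
  alternating axes s (rev l) = (-1) ^+ 'C(size l, 2) * alternating axes s l.
Proof.
elim: axes s l => [|a r IH] s l /=.
  by case: l => [|x l]; rewrite ?mul1r // rev_cons; case: (rev l) => [|? ?] /=; rewrite mulr0.
rewrite IH mulrDr; congr (_ + _).
have := wedge_rev (fun x => (x == (s, a))%:R) (alternating r (~~ s)) l.
rewrite (@eq_wedge _ _ _ (fun u => (-1) ^+ 'C((size l).-1, 2) * alternating r (~~ s) u)).
  rewrite wedgeMr; case: l => [|x l] /=; first by rewrite mulr0.
  rewrite binS bin1 exprD exprS; move: (wedge _ _ _) => A.
  move: (_ - A) => B.
  by rewrite -(signr_odd _ (size l)); case: (odd _); rewrite ?expr1 ?expr0; lra.
by move=> u _ <-; rewrite IH.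
Qed.

Lemma alternating_repeat axes s l1 x l2 :
  alternating axes s (l1 ++ x :: x :: l2) = 0.
Proof.
elim: axes s l1 x l2 => [|a r IH] s l1 x l2 /=; first by case: l1.
by rewrite IH add0r wedge_repeat.
Qed.

Lemma opp_labelK : involutive opp_label.
Proof. by move=> [s a]; rewrite /opp_label /= negbK. Qed.

Lemma alternating_opp axes s l :
  alternating axes s (map opp_label l) = alternating axes (~~ s) l.
Proof.
elim: axes s l => [|a r IH] s l /=; first by case: l.
rewrite IH wedge_map; congr (_ + _).
rewrite (eq_wedgel (d := fun x => (x == (~~ s, a))%:R)).
  by apply: eq_wedge => u _ _; rewrite IH.
by move=> x _; rewrite (can2_eq opp_labelK opp_labelK).
Qed.

Lemma prism_id_repeat (T : eqType) (f : seq T -> int) l :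
  (forall u1 y u2, f (u1 ++ y :: y :: u2) = 0) -> prism id id f l = 0.
Proof.
elim: l f => //= x l IH f f0; rewrite (f0 [::]) IH ?subrr // => u1 y u2.
exact: (f0 (x :: u1)).
Qed.

Section Degree.
Variables (N : nat) (axes : seq nat).
Hypothesis uniq_axes : uniq axes.
Implicit Types (n : nat) (lam : seq nat -> label).

(** With n+1 axes a single facet of the cross-polytope alternates from [s], and this is the signed
    number of simplices mapped onto it. *)
Definition degree s n lam : int :=
  box N n (fun l => alternating axes s (map lam l)).

Definition labelling n lam :=
  (forall l, in_cube N n l -> consistent (map lam l)) /\
  (forall p, grid N n p -> (lam p).2 \in axes).

Lemma in_cube_grid n l p : in_cube N n l -> p \in l -> grid N n p.
Proof. by move=> [/allP lg _] /lg. Qed.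

Lemma eq_degree s n lam lam' :
  (forall p, grid N n p -> lam p = lam' p) -> degree s n lam = degree s n lam'.
Proof.
move=> e; apply: eq_box => l lc _; congr alternating.
by apply/eq_in_map => p /(in_cube_grid lc); apply: e.
Qed.

Lemma degree_opp s n lam :
  degree s n (fun p => opp_label (lam p)) = degree (~~ s) n lam.
Proof. by apply: eq_box => l _ _; rewrite (map_comp opp_label lam) alternating_opp. Qed.

(** The signs of [box_refl] and [alternating_rev] have exponents C(n,2) and C(n+1,2), which differ
    by n. *)
Lemma degree_refl s n lam :
  degree s n (fun p => lam (refl N p)) = (-1) ^+ n * degree s n lam.
Proof.
have e : forall l, size l = n.+1 -> alternating axes s (map (fun p => lam (refl N p)) l) =
  (-1) ^+ 'C(n.+1, 2) * alternating axes s (map lam (rev (map (refl N) l))).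
  move=> l sl; rewrite map_rev alternating_rev !size_map sl mulrA -expr2 sqrr_sign mul1r.
  by rewrite -map_comp.
rewrite /degree (eq_box (g := fun l => (-1) ^+ 'C(n.+1, 2) *
   alternating axes s (map lam (rev (map (refl N) l))))); last by move=> l _; apply: e.
rewrite boxM (box_refl N n (fun l => alternating axes s (map lam l))).
rewrite binS bin1 addnC exprD mulrA -(mulrA (_ ^+ n)).
by rewrite -expr2 sqrr_sign mulr1.
Qed.

Definition side_flux s n lam : int :=
  box N n (coboundary (slab N (fun l => alternating axes s (map lam l)))).

Lemma degree_stokes s n lam : labelling n.+1 lam ->
  degree (~~ s) n.+1 lam - (-1) ^+ n.+2 * degree s n.+1 lam =
  degree s n (fun p => lam (N :: p)) - degree s n (fun p => lam (0%N :: p)) -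
  side_flux s n lam.
Proof.
move=> [lc la]; rewrite -[RHS](_ : box N n.+1
  (coboundary (fun l => alternating axes s (map lam l))) = _); last first.
  rewrite stokes /side_flux; congr (_ - _); congr (_ - _);
  by apply: eq_box => l _ _; rewrite -map_comp.
rewrite /degree -boxM -boxB; apply: eq_box => l l_c sl.
rewrite /coboundary -(wedge_map lam (fun=> 1)) -/(coboundary _ _).
rewrite alternating_coboundary ?size_map ?sl //; first exact: lc.
by move=> _ /mapP[p pl ->]; apply: la; apply: in_cube_grid pl.
Qed.

Lemma on_face_boundary n l p : in_cube N n l -> on_face N n l -> p \in l -> boundary N n p.
Proof.
move=> lc [i ni h] pl; rewrite /boundary (in_cube_grid lc pl) /=.
have /andP[/eqP sp _] := in_cube_grid lc pl.
apply/hasP; exists (nth 0%N p i); first by rewrite mem_nth ?sp.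
by case: h => /(_ _ pl) ->; rewrite eqxx ?orbT.
Qed.

(** Labels constant in height give every prism over the boundary a repeated label. *)
Lemma side_flux0 s n lam :
  (forall p t, boundary N n p -> (t < N)%N -> lam (t.+1 :: p) = lam (t :: p)) ->
  side_flux s n lam = 0.
Proof.
move=> e; apply: box_coboundary0 => [|l lc lf]; first exact: slab_nil.
rewrite /slab big1 // => t _.
rewrite (prism_map (i' := id) (j' := id) (h := fun p => lam ((t : nat) :: p))) //.
  by apply: prism_id_repeat => u1 y u2; apply: alternating_repeat.
by move=> p pl; rewrite e //; apply: on_face_boundary pl.
Qed.

(** The difference of the two slabs vanishes over the boundary, so [box_coboundary0] applies to
    it. *)
Lemma eq_side_flux s n lam lam' :
  (forall p t, boundary N n p -> (t <= N)%N -> lam (t :: p) = lam' (t :: p)) ->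
  side_flux s n lam = side_flux s n lam'.
Proof.
move=> e; apply/eqP; rewrite -subr_eq0 /side_flux -boxB; apply/eqP.
rewrite -[LHS](_ : box N n (coboundary (fun l =>
   slab N (fun l => alternating axes s (map lam l)) l -
   slab N (fun l => alternating axes s (map lam' l)) l)) = _); last first.
  by apply: eq_box => l _ _; rewrite /coboundary wedgeBr.
apply: box_coboundary0 => [|l lc lf]; first by rewrite !slab_nil subrr.
apply/eqP; rewrite subr_eq0; apply/eqP; apply: eq_bigr => t _.
apply: eq_prism => u _ ul; congr alternating; apply/eq_in_map => p /ul.
rewrite mem_cat => /orP[] /mapP[q /(on_face_boundary lc lf) qb ->];
by apply: e => //; rewrite 1?ltnW.
Qed.

(* Ky Fan's lemma: the vertical sides of [lam'] are degenerate, and its top   *)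
(* and bottom together contribute both kinds of alternating simplices.        *)
Lemma degree_fan n lam lam' : labelling n.+1 lam' ->
  (forall p, grid N n p -> lam' (N :: p) = lam p) ->
  (forall p, grid N n p -> lam' (0%N :: p) = opp_label (lam (refl N p))) ->
  (forall p t, boundary N n p -> (t <= N)%N -> lam' (t :: p) = lam p) ->
  odd `|(degree true n lam + degree false n lam)%R|%N ->
  odd `|(degree true n.+1 lam' + degree false n.+1 lam')%R|%N.
Proof.
move=> ll top bot side o.
have := degree_stokes true ll; rewrite side_flux0 ?subr0; last first.
  by move=> p t pb tN; rewrite !side // ltnW.
rewrite (eq_degree true top) (eq_degree true bot).
rewrite (degree_opp true n (fun p => lam (refl N p))) degree_refl /= !exprS.
rewrite -signr_odd; case: (odd n); rewrite ?expr1 ?expr0; move: o; lia.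
Qed.

Lemma in_cube_refl n l : in_cube N n l -> in_cube N n (map (refl N) l).
Proof.
move=> [/allP lg [b lb]]; split.
  by apply/allP => _ /mapP[p /lg /grid_refl pg ->].
exists (mkseq (fun i => (N - nth 0 b i).-1)%N n) => _ i /mapP[p pl ->] ni.
have /andP[/eqP sp /allP pN] := lg _ pl.
have := pN _ (mem_nth 0%N (s := p) (n := i) _); rewrite sp => /(_ ni).
have := lb _ _ pl ni.
rewrite nth_mkseq // (nth_map 0%N) ?sp //; lia.
Qed.

Lemma labelling_refl n lam : labelling n lam -> labelling n (fun p => lam (refl N p)).
Proof.
move=> [lc la]; split=> [l /in_cube_refl/lc|p /grid_refl/la //].
by rewrite -map_comp.
Qed.

(** With so few axes no n+2 labels alternate, so the alternating cochain is closed on the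
    cylinder. *)
Lemma side_flux_cocycle s n lam : (size axes <= n.+1)%N -> labelling n.+1 lam ->
  side_flux s n lam =
  degree s n (fun p => lam (N :: p)) - degree s n (fun p => lam (0%N :: p)).
Proof.
move=> sa ll; have := degree_stokes s ll.
have d0 : forall s, degree s n.+1 lam = 0.
  by move=> s'; apply: box0 => l _ sl; rewrite alternating_size // size_map sl.
by rewrite !d0 mulr0 subrr; lra.
Qed.

(* The height is reversed in the hypothesis because the Kuhn triangulation is *)
(* only invariant under the simultaneous reflection of all coordinates.       *)
Lemma degree_homotopy s n lam lam' :
  ~~ odd n -> (size axes <= n.+1)%N -> labelling n.+1 lam -> labelling n.+1 lam' ->
  (forall p t, boundary N n p -> (t <= N)%N -> lam' (t :: p) = lam (refl N (t :: p))) ->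
  degree s n (fun p => lam (N :: p)) - degree s n (fun p => lam' (0%N :: p)) =
  degree s n (fun p => lam (0%N :: p)) - degree s n (fun p => lam' (N :: p)).
Proof.
move=> n_even sa ll ll' side.
have := side_flux_cocycle s sa ll'.
rewrite (@eq_side_flux s n lam' (fun p => lam (refl N p))) // side_flux_cocycle //; last first.
  exact: labelling_refl.
rewrite /= subnn subn0 !(degree_refl s n (fun p => lam (_ :: p))).
rewrite -signr_odd (negbTE n_even) !mul1r; lra.
Qed.

(** A single label alternates from its own sign only. *)
Lemma degree_dim0 lam : (lam [::]).2 \in axes ->
  degree true 0 lam + degree false 0 lam = 1.
Proof.
rewrite /degree /=; case: (lam [::]) => t a /=.
elim: axes uniq_axes => //= b r IH /andP[br ur].
rewrite inE !xpair_eqE; case: (a =P b) => [-> _|_ /IH -/(_ ur)] /=; last first.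
  by rewrite !andbF !mul0r !subr0.
have d0 : forall (r : seq nat) s, b \notin r -> alternating r s [:: (t, b)] = 0.
  elim=> [|c r' IHr] s //; rewrite inE negb_or => /andP[bc br'] /=.
  by rewrite IHr // xpair_eqE (negbTE bc) andbF mul0r subr0.
have d1 : forall (r : seq nat) s, alternating r s [::] = 1.
  by elim=> [|c r' IHr] s //=; rewrite IHr.
by rewrite (d0 r true) // (d0 r false) // !d1 !andbT; case: (t).
Qed.

End Degree.

(** * Extension of antipodal maps *)

Section Gluing.
Variables (R : realType) (X Y : topologicalType).

Lemma continuous_glue (c : X -> R) (f g : X -> Y) :
  continuous c -> continuous f -> continuous g ->
  (forall x, c x = 0 -> f x = g x) ->
  continuous (fun x => if c x <= 0 then f x else g x).
Proof.
move=> cc cf cg fg x U /=.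
have cU (h : X -> Y) : continuous h -> nbhs (h x) U -> nbhs x [set y | U (h y)]%classic.
  by move=> ch; apply: ch.
have [c0|c0] := leP (c x) 0 => nU; last first.
  have : \forall y \near x, 0 < c y by apply: (cvgr_gt (c x)) => //; exact: cc.
  have := cU _ cg nU; apply: filterS2 => y /= Uy cy.
  by rewrite leNgt cy.
move: c0; rewrite le_eqVlt => /orP[/eqP c0|c0].
  have := cU _ cg; rewrite -(fg x c0) => /(_ nU).
  have := cU _ cf nU; apply: filterS2 => y /= Uf Ug.
  by case: ifP.
have : \forall y \near x, c y < 0 by apply: (cvgr_lt (c x)) => //; exact: cc.
have := cU _ cf nU; apply: filterS2 => y /= Uy cy.
by rewrite (ltW cy).
Qed.

Lemma continuous_within_comp (Z : topologicalType) (A : set Y) (f : X -> Y) (g : Y -> Z) :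
  continuous f -> (forall x, A (f x)) -> {within A, continuous g}%classic ->
  continuous (fun x => g (f x)).
Proof.
move=> cf Af /subspace_continuousP cg x U nU.
have := cg _ (Af x) U nU; rewrite /within /= /nbhs /= => h.
have := cf x _ h; rewrite /nbhs /=; apply: filterS => y /= h'.
exact: h' (Af y).
Qed.

Lemma continuous_comp_fun (Z : topologicalType) (f : X -> Y) (g : Y -> Z) :
  continuous f -> continuous g -> continuous (fun x => g (f x)).
Proof. by move=> cf cg x; exact: (@continuous_comp _ _ _ f g x (cf x) (cg (f x))). Qed.

Lemma continuous_addr (f g : X -> R) :
  continuous f -> continuous g -> continuous (fun x => f x + g x).
Proof. by move=> cf cg x; exact: (cvgD (cf x) (cg x)). Qed.

Lemma continuous_subr (f g : X -> R) :
  continuous f -> continuous g -> continuous (fun x => f x - g x).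
Proof. by move=> cf cg x; exact: (cvgB (cf x) (cg x)). Qed.

Lemma continuous_mulr (f g : X -> R) :
  continuous f -> continuous g -> continuous (fun x => f x * g x).
Proof. by move=> cf cg x; exact: (cvgM (cf x) (cg x)). Qed.

Lemma continuous_minr (f g : X -> R) :
  continuous f -> continuous g -> continuous (fun x => Num.min (f x) (g x)).
Proof. by move=> cf cg x; exact: (continuous_min (cf x) (cg x)). Qed.

Lemma continuous_maxr (f g : X -> R) :
  continuous f -> continuous g -> continuous (fun x => Num.max (f x) (g x)).
Proof. by move=> cf cg x; exact: (continuous_max (cf x) (cg x)). Qed.

End Gluing.

Section RowVectors.
Variable R : realType.

Lemma rV_coord_le n (x : 'rV[R]_n) i : `|x ord0 i| <= `|x|.
Proof.
rewrite [leRHS]/Num.norm /= mx_normrE.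
exact: (le_bigmax _ (fun ij : 'I_1 * 'I_n => `|x ij.1 ij.2|) (ord0, i)).
Qed.

Lemma rV_norm_le n (x : 'rV[R]_n) c : 0 <= c ->
  (forall i, `|x ord0 i| <= c) -> `|x| <= c.
Proof.
move=> c0 xc; rewrite [leLHS]/Num.norm /= mx_normrE.
by apply: bigmax_le => // -[j i] _; rewrite ord1.
Qed.

Definition rV_cons n (t : R) (x : 'rV[R]_n) : 'rV[R]_n.+1 :=
  \row_j oapp (x ord0) t (unlift ord0 j).

Definition rV_tail n (x : 'rV[R]_n.+1) : 'rV[R]_n := \row_j x ord0 (lift ord0 j).

Lemma rV_cons_head n t (x : 'rV[R]_n) : rV_cons t x ord0 ord0 = t.
Proof. by rewrite mxE unlift_none. Qed.

Lemma rV_cons_tail n t (x : 'rV[R]_n) : rV_tail (rV_cons t x) = x.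
Proof. by apply/rowP => j; rewrite !mxE liftK. Qed.

Lemma rV_consN n t (x : 'rV[R]_n) : - rV_cons t x = rV_cons (- t) (- x).
Proof.
by apply/rowP => j; rewrite !mxE; case: (unlift ord0 j) => [k|] /=; rewrite ?mxE.
Qed.

Lemma rV_tailN n (x : 'rV[R]_n.+1) : rV_tail (- x) = - rV_tail x.
Proof. by apply/rowP => j; rewrite !mxE. Qed.

Lemma rV_tail_continuous n : continuous (@rV_tail n).
Proof.
move=> x U /nbhs_ballP[e e0 eU]; apply/nbhs_ballP; exists e => // y [_ xy].
by apply: eU; split=> // i j; rewrite !mxE; apply: xy.
Qed.

Lemma rV_norm_cons_ge1 n (x : 'rV[R]_n.+1) : 1 <= `|x| ->
  [\/ 1 <= x ord0 ord0, x ord0 ord0 <= -1 | 1 <= `|rV_tail x|].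
Proof.
move=> x1; case: (lerP 1 (x ord0 ord0)) => [|h1]; first by constructor 1.
case: (lerP (x ord0 ord0) (-1)) => [|h2]; first by constructor 2.
constructor 3; rewrite leNgt; apply/negP => h3; move: x1; apply/negP; rewrite -ltNge.
apply: (@le_lt_trans _ _ (Num.max `|x ord0 ord0| `|rV_tail x|)); last first.
  by rewrite gt_max h3 ltr_norml h1 h2.
apply: rV_norm_le => [|i]; first by rewrite le_max normr_ge0.
rewrite le_max; case: (unliftP ord0 i) => [j ->|->]; last by rewrite lexx.
have -> : x ord0 (lift ord0 j) = rV_tail x ord0 j by rewrite mxE.
by rewrite rV_coord_le orbT.
Qed.

End RowVectors.

(** * Raising the dimension of an equivariant sphere by one *)

Section Extension.
Variables (R : realType) (X : topologicalType) (T : X -> X).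
Hypotheses (T_cont : continuous T) (T_inv : involutive T).

(** A map of the ball [-1,1]^n, the unit ball of the sup norm, is a hemisphere with equivariant
    equator. Maps being total, the condition is imposed on everything outside the open ball. *)
Definition antipodal n (e : 'rV[R]_n -> X) :=
  forall x, 1 <= `|x| -> e (- x) = T (e x).

Definition retract n (x : 'rV[R]_n) : 'rV[R]_n := (Num.max 1 `|x|)^-1 *: x.

Lemma retract_continuous n : continuous (@retract n).
Proof.
move=> x; apply: (@continuousZ R _ _ (fun y : 'rV[R]_n => (Num.max 1 `|y|)^-1) id).
  2: exact: cvg_id.
apply: continuousV; first by rewrite gt_eqF // lt_max ltr01.
apply: (@continuous_maxr _ _ (fun=> 1) (fun y : 'rV[R]_n => `|y|)).
  exact: cst_continuous.
exact: norm_continuous.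
Qed.

Lemma retract_id n (x : 'rV[R]_n) : `|x| <= 1 -> retract x = x.
Proof. by move=> x1; rewrite /retract max_l // invr1 scale1r. Qed.

Lemma retract_norm n (x : 'rV[R]_n) : `|retract x| <= 1.
Proof.
have m0 : 0 < Num.max 1 `|x| by rewrite lt_max ltr01.
rewrite normrZ ger0_norm ?invr_ge0 ?(ltW m0) // mulrC ler_pdivrMr // mul1r.
by rewrite le_max lexx orbT.
Qed.

Definition clamp (t : R) : R := Num.min (Num.max t 0) 1.

Lemma clamp_continuous : continuous clamp.
Proof.
apply: continuous_minr; last exact: cst_continuous.
by apply: continuous_maxr => y; [exact: cvg_id|exact: cst_continuous].
Qed.

Lemma clamp01 t : 0 <= clamp t <= 1.
Proof.
rewrite /clamp /Num.min /Num.max; case: (ltP t 0) => ?; case: ltP => ?; lra.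
Qed.

Lemma clamp_le0 t : t <= 0 -> clamp t = 0.
Proof.
rewrite /clamp /Num.min /Num.max => ?; case: (ltP t 0) => ?; case: ltP => ?; lra.
Qed.

Lemma clamp_ge1 t : 1 <= t -> clamp t = 1.
Proof.
rewrite /clamp /Num.min /Num.max => ?; case: (ltP t 0) => ?; case: ltP => ?; lra.
Qed.

Definition to_cube n (x : 'rV[R]_n) : 'rV[R]_n := 2^-1 *: (x + const_mx 1).

Definition of_cube n (s : 'rV[R]_n) : 'rV[R]_n := 2 *: s - const_mx 1.

Lemma to_cubeK n : cancel (@to_cube n) (@of_cube n).
Proof. by move=> x; apply/rowP => j; rewrite !mxE; lra. Qed.

Lemma to_cube_cube n (x : 'rV[R]_n) : `|x| <= 1 -> cube (to_cube x).
Proof.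
move=> x1 i; rewrite !mxE; have := le_trans (rV_coord_le x i) x1.
rewrite ler_norml; lra.
Qed.

Lemma of_cube_norm n (s : 'rV[R]_n) : cube s -> `|of_cube s| <= 1.
Proof.
move=> cs; apply: rV_norm_le => // i; rewrite !mxE ler_norml.
have := cs i; lra.
Qed.

Lemma of_cube_boundary n (s : 'rV[R]_n) : cube_boundary s -> `|of_cube s| = 1.
Proof.
move=> [cs [i si]]; apply/eqP; rewrite eq_le of_cube_norm //=.
have := rV_coord_le (of_cube s) i; rewrite !mxE; apply: le_trans.
by case: si => ->; rewrite ler_normr; apply/orP; [right|left]; lra.
Qed.

Lemma to_cube_boundary n (x : 'rV[R]_n) : `|x| = 1 -> cube_boundary (to_cube x).
Proof.
move=> x1; split; first by apply: to_cube_cube; rewrite x1.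
have [[i j] /= h] : exists i, `|x| = `|x i.1 i.2|.
  apply: mx_norm_neq0; rewrite -[mx_norm x]/(`|x|) x1 oner_eq0 //.
exists j; rewrite !mxE; move: h; rewrite x1 ord1 => h.
have [x0|x0] := lerP 0 (x ord0 j); move: h.
  by rewrite ger0_norm // => <-; right; lra.
by rewrite ltr0_norm // => h; left; lra.
Qed.

Lemma of_cube_continuous n : continuous (@of_cube n).
Proof.
move=> x; apply: (@continuousB R _ _ (fun y : 'rV[R]_n => 2 *: y) (fun=> const_mx 1)).
  by apply: (@continuousZ R _ _ (fun=> 2) id); [exact: cst_continuous|exact: cvg_id].
exact: cst_continuous.
Qed.

Lemma to_cube_continuous n : continuous (@to_cube n).
Proof.
move=> x; apply: (@continuousZ R _ _ (fun=> 2^-1) (fun y : 'rV[R]_n => y + const_mx 1)).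
  exact: cst_continuous.
by apply: (@continuousD R _ _ id (fun=> const_mx 1)); [exact: cvg_id|exact: cst_continuous].
Qed.

(** Composing with [retract] and [clamp] makes a homotopy that is continuous only within the cube
    continuous everywhere. *)
Lemma ball_homotopy n (x0 : X) (f g : 'rV[R]_n -> X) :
  @pi_vanishes R X n x0 -> continuous f -> continuous g ->
  (forall x, `|x| = 1 -> f x = x0) -> (forall x, `|x| = 1 -> g x = x0) ->
  exists G : 'rV[R]_n * R -> X,
    [/\ continuous G, forall x, `|x| <= 1 -> G (x, 0) = f x,
        forall x, `|x| <= 1 -> G (x, 1) = g x &
        forall x t, `|x| = 1 -> 0 <= t <= 1 -> G (x, t) = x0].
Proof.
move=> pi0 cf cg f0 g0.
have sph (u : 'rV[R]_n -> X) : continuous u -> (forall x, `|x| = 1 -> u x = x0) ->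
    spheroid x0 (fun s => u (of_cube s)).
  move=> cu u0; split=> [|s /of_cube_boundary/u0 //].
  apply: continuous_subspaceT => x; apply: continuous_comp; last exact: cu.
  exact: of_cube_continuous.
have [H [cH H0 H1 Hb]] := pi0 _ _ (sph f cf f0) (sph g cg g0).
exists (fun p => H (to_cube (retract p.1), clamp p.2)); split.
- have := @continuous_within_comp _ _ _ _
    (fun p : 'rV[R]_n * R => (to_cube (retract p.1), clamp p.2)) _ _ _ cH.
  apply.
    have c1 : continuous (fun p : 'rV[R]_n * R => to_cube (retract p.1)).
      move=> p; apply: (@continuous_comp _ _ _ fst (fun x => to_cube (retract x))).
        exact: cvg_fst.
      apply: continuous_comp; [exact: retract_continuous|exact: to_cube_continuous].
    have c2 : continuous (fun p : 'rV[R]_n * R => clamp p.2).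
      move=> p; apply: (@continuous_comp _ _ _ snd clamp); first exact: cvg_snd.
      exact: clamp_continuous.
    by move=> p; exact: (cvg_pair (c1 p) (c2 p)).
  move=> p; split => /=; first by apply: to_cube_cube; apply: retract_norm.
  by rewrite in_itv /=; apply: clamp01.
- move=> x x1; rewrite /= retract_id // clamp_le0 // H0 ?to_cubeK //.
  exact: to_cube_cube.
- move=> x x1; rewrite /= retract_id // clamp_ge1 // H1 ?to_cubeK //.
  exact: to_cube_cube.
- move=> x t x1 t01; rewrite /= retract_id ?x1 // Hb ?clamp01 //.
  exact: to_cube_boundary.
Qed.

Section Step.
Variables (n : nat) (e : 'rV[R]_n -> X).
Hypotheses (e_cont : continuous e) (e_anti : antipodal e).
Hypothesis pi_n : forall x0 : X, @pi_vanishes R X n x0.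

(** The opposite hemisphere, parametrized so as to agree with [e] on the equator. *)
Let b (x : 'rV[R]_n) := T (e (- x)).

Let b_cont : continuous b.
Proof.
have cN : continuous (fun x : 'rV[R]_n => - x).
  by move=> x; apply: (@continuousN R _ _ id); exact: cvg_id.
exact: continuous_comp_fun (continuous_comp_fun cN e_cont) T_cont.
Qed.

Let b_out x : 1 <= `|x| -> b x = e x.
Proof. by move=> x1; rewrite /b e_anti // T_inv. Qed.

Let bN x : b (- x) = T (e x).
Proof. by rewrite /b opprK. Qed.

Let scale_continuous (Y : topologicalType) (k : Y -> R) (f : Y -> 'rV[R]_n)
    (u : 'rV[R]_n -> X) :
  continuous k -> continuous f -> continuous u -> continuous (fun y => u (k y *: f y)).
Proof.
move=> ck cf cu; apply: continuous_comp_fun cu => y.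
exact: (@continuousZ R _ _ k f y (ck y) (cf y)).
Qed.

(** Spheroids need a constant boundary value: the outer shell leads the equator back along the radii
    of [b] to its centre. *)
Let double (u : 'rV[R]_n -> X) (x : 'rV[R]_n) :=
  if `|x| - 2^-1 <= 0 then u (2 *: x) else b ((4 * (1 - `|x|)) *: x).

Let double_continuous u : continuous u -> (forall x, `|x| = 1 -> u x = b x) ->
  continuous (double u).
Proof.
move=> cu ub; apply: continuous_glue.
- by apply: continuous_subr; [exact: norm_continuous|exact: cst_continuous].
- apply: (@scale_continuous _ (fun=> 2) id) => //; first exact: cst_continuous.
  by move=> x; exact: cvg_id.
- apply: (@scale_continuous _ (fun x : 'rV[R]_n => 4 * (1 - `|x|)) id) => //.
    apply: continuous_mulr; first exact: cst_continuous.
    by apply: continuous_subr; [exact: cst_continuous|exact: norm_continuous].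
  by move=> x; exact: cvg_id.
- move=> x /eqP; rewrite subr_eq0 => /eqP x2.
  rewrite ub ?normrZ ?x2 ?ger0_norm ?mulfV //.
  by congr (b (_ *: x)); lra.
Qed.

Let double_sphere u x : `|x| = 1 -> double u x = b 0.
Proof.
rewrite /double => ->; case: ifP => [h|_]; last by rewrite subrr mulr0 scale0r.
by exfalso; lra.
Qed.

(** [nu] is the radius to which the sphere |x| = 1/2 is pushed: from 1/2 to 1 in the first third of
    time, back in the last; [theta] runs the homotopy in the middle third. By [double_half] the
    pushed point takes the value b ((2 * kappa) *: x), and [K] interpolates from 2 * kappa at |x| =
    1/2 to 1 on the equator. *)
Let nu (t : R) : R := Num.min 1 (2^-1 + 3 / 2 * Num.min t (1 - t)).
Let theta (t : R) : R := clamp (3 * t - 1).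
Let kappa (t : R) : R := 4 * nu t * (1 - nu t).
Let rho (x : 'rV[R]_n) : R := Num.min `|x| 1.
Let K (x : 'rV[R]_n) (t : R) : R :=
  2 * kappa t * (2 - 2 * rho x) + (2 * rho x - 1).

Let nu_bounds t : 0 <= t <= 1 -> 2^-1 <= nu t <= 1.
Proof.
move=> t01; rewrite /nu /Num.min; case: (ltP t) => ?; case: ltP => ?; lra.
Qed.

Let nu_middle t : 3^-1 <= t <= 2 / 3 -> nu t = 1.
Proof.
move=> ht; rewrite /nu /Num.min; case: (ltP t) => ?; case: ltP => ?; lra.
Qed.

Let nu0 : nu 0 = 2^-1.
Proof. by rewrite /nu (min_l (x := 0)) ?min_r; lra. Qed.

Let nu1 : nu 1 = 2^-1.
Proof. by rewrite /nu (min_r (x := 1)) ?min_r; lra. Qed.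

Let nu_continuous : continuous nu.
Proof.
apply: continuous_minr; first exact: cst_continuous.
apply: continuous_addr; first exact: cst_continuous.
apply: continuous_mulr; first exact: cst_continuous.
apply: continuous_minr; first by move=> x; exact: cvg_id.
by apply: continuous_subr; [exact: cst_continuous|move=> x; exact: cvg_id].
Qed.

Let theta_continuous : continuous theta.
Proof.
apply: continuous_comp_fun clamp_continuous.
apply: continuous_subr; last exact: cst_continuous.
by apply: continuous_mulr; [exact: cst_continuous|move=> x; exact: cvg_id].
Qed.

Let kappa_continuous : continuous kappa.
Proof.
apply: continuous_mulr.
  by apply: continuous_mulr; [exact: cst_continuous|exact: nu_continuous].
by apply: continuous_subr; [exact: cst_continuous|exact: nu_continuous].
Qed.

Let K_continuous : continuous (fun p : 'rV[R]_n * R => K p.1 (clamp p.2)).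
Proof.
have c1 : continuous (fun p : 'rV[R]_n * R => kappa (clamp p.2)).
  apply: continuous_comp_fun kappa_continuous.
  by apply: continuous_comp_fun clamp_continuous => p; exact: cvg_snd.
have c2 : continuous (fun p : 'rV[R]_n * R => 2 * rho p.1).
  apply: continuous_mulr; first exact: cst_continuous.
  apply: continuous_minr; last exact: cst_continuous.
  apply: (@continuous_comp_fun _ _ _ fst (fun x : 'rV[R]_n => `|x|)).
    by move=> p; exact: cvg_fst.
  exact: norm_continuous.
apply: continuous_addr; last by apply: continuous_subr => //; exact: cst_continuous.
apply: continuous_mulr; first by apply: continuous_mulr => //; exact: cst_continuous.
by apply: continuous_subr => //; exact: cst_continuous.
Qed.

Let double_half u x t : (forall x, `|x| = 1 -> u x = b x) -> `|x| = 2^-1 ->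
  2^-1 <= t <= 1 -> double u ((2 * t) *: x) = b ((2 * (4 * t * (1 - t))) *: x).
Proof.
move=> ub x2 t01; rewrite /double normrZ x2 ger0_norm; last by lra.
case: ifP => [t2|_]; last by rewrite scalerA; congr (b (_ *: x)); lra.
have -> : t = 2^-1 by lra.
rewrite scalerA ub; last by rewrite normrZ x2 ger0_norm; lra.
by congr (b (_ *: x)); lra.
Qed.

(* The two spheroids formed by [e], resp. [b], on the inner half ball and by   *)
(* [b] on the outer shell, contracted to its centre, are homotopic by [G].     *)
(* Each point of the sphere |x| = 1/2 of [G] is pushed outwards along the      *)
(* bottom, up the boundary and back along the top; on it [G] runs through a    *)
(* path and back, which is undone in the outer shell by the factor [K].        *)
Lemma cylinder_homotopy : exists E : 'rV[R]_n * R -> X,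
  [/\ continuous E,
      forall x t, 1 <= `|x| -> E (x, t) = e x,
      forall x t, t <= 0 -> E (x, t) = E (x, 0) &
      forall x t, 1 <= t -> E (x, t) = T (E (- x, 0))].
Proof.
have eb x : `|x| = 1 -> e x = b x by move=> x1; rewrite b_out ?x1.
have [||||G [G_cont G0 G1 Gb]] := ball_homotopy (@pi_n (b 0)) (f := double e) (g := double b).
- exact: double_continuous.
- exact: double_continuous.
- exact: double_sphere.
- exact: double_sphere.
pose E' (p : 'rV[R]_n * R) := if `|p.1| - 2^-1 <= 0
   then G ((2 * nu (clamp p.2)) *: p.1, theta (clamp p.2))
   else b (K p.1 (clamp p.2) *: p.1).
have E'0 x t : t <= 0 -> E' (x, t) = if `|x| - 2^-1 <= 0 then e (2 *: x)
    else b ((3 - 2 * rho x) *: x).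
  move=> t0; rewrite /E' /= clamp_le0 // nu0 /theta clamp_le0; last by lra.
  rewrite /K /kappa nu0; case: ifP => x2; last by congr (b (_ *: x)); lra.
  rewrite mulfV // scale1r G0; last by lra.
  by rewrite /double x2.
have E'1 x t : 1 <= t -> E' (x, t) = if `|x| - 2^-1 <= 0 then b (2 *: x)
    else b ((3 - 2 * rho x) *: x).
  move=> t0; rewrite /E' /= clamp_ge1 // nu1 /theta clamp_ge1; last by lra.
  rewrite /K /kappa nu1; case: ifP => x2; last by congr (b (_ *: x)); lra.
  rewrite mulfV // scale1r G1; last by lra.
  by rewrite /double x2.
have fst_cont : continuous (fun p : 'rV[R]_n * R => p.1) by move=> p; exact: cvg_fst.
have tau_cont : continuous (fun p : 'rV[R]_n * R => clamp p.2).
  by apply: continuous_comp_fun clamp_continuous => p; exact: cvg_snd.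
have out_cont := scale_continuous K_continuous fst_cont b_cont.
exists E'; split.
- apply: continuous_glue.
  + apply: continuous_subr; last exact: cst_continuous.
    by apply: continuous_comp_fun fst_cont _; exact: norm_continuous.
  + apply: continuous_comp_fun G_cont.
    have c1 : continuous (fun p : 'rV[R]_n * R => (2 * nu (clamp p.2)) *: p.1).
      move=> p; apply: (@continuousZ R _ _ (fun p : 'rV[R]_n * R => 2 * nu (clamp p.2))).
        apply: continuous_mulr; first exact: cst_continuous.
        exact: continuous_comp_fun tau_cont nu_continuous.
      exact: fst_cont.
    have c2 := continuous_comp_fun tau_cont theta_continuous.
    by move=> p; exact: (cvg_pair (c1 p) (c2 p)).
  + exact: out_cont.
  + move=> [x t] /= /eqP; rewrite subr_eq0 => /eqP x2.
    have t01 := clamp01 t; move: (clamp t) t01 => {}t t01.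
    have nut := nu_bounds t01.
    have rx : rho x = 2^-1 by rewrite /rho x2 min_l //; lra.
    have -> : K x t = 2 * kappa t by rewrite /K rx; lra.
    have nx : `|(2 * nu t) *: x| = nu t by rewrite normrZ x2 ger0_norm; lra.
    have [t3|t3] := lerP t 3^-1.
      have -> : theta t = 0 by apply: clamp_le0; lra.
      rewrite G0 ?nx; last by lra.
      by rewrite double_half.
    have [t6|t6] := lerP (2 / 3) t.
      have -> : theta t = 1 by apply: clamp_ge1; lra.
      rewrite G1 ?nx; last by lra.
      by rewrite double_half.
    have n1 : nu t = 1 by apply: nu_middle; lra.
    rewrite Gb ?clamp01 //; last by rewrite nx.
    by rewrite /kappa n1 subrr !mulr0 scale0r.
- move=> x t x1; rewrite /E' /=; case: ifP => [x2|_]; first by exfalso; lra.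
  rewrite /K /rho min_r // -b_out //; congr (b _).
  by rewrite -[RHS]scale1r; congr (_ *: _); lra.
- by move=> x t t0; rewrite !E'0.
- move=> x t t1; rewrite E'1 // E'0 // normrN; case: ifP => x2.
    by rewrite /b scalerN.
  rewrite scalerN bN T_inv /rho normrN b_out //.
  (* For r = |x| in [1/2, 1], (3 - 2r)r - 1 = (2r - 1)(1 - r) >= 0, so [b] is taken outside the open
     ball, where it equals [e]. *)
  rewrite normrZ /Num.min; case: ltP => x1; rewrite ger0_norm; nra.
Qed.

(* On the boundary of the cube [e'] is the suspension of [a], so that its top  *)
(* and bottom faces are the hemispheres [a x] and [T (a (- x))].               *)
Lemma extend_antipodal : exists (a : 'rV[R]_n -> X) (e' : 'rV[R]_n.+1 -> X),
  [/\ continuous a /\ antipodal a, forall x, `|x| = 1 -> a x = e x,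
      continuous e' /\ antipodal e',
      forall x, e' (rV_cons 1 x) = a x &
      forall x t, `|x| = 1 -> e' (rV_cons t x) = a x].
Proof.
have [E [E_cont E_out E0 E1]] := cylinder_homotopy.
exists (fun x => E (x, 0)), (fun y => E (rV_tail y, (1 - y ord0 ord0) / 2)).
split.
- split; last by move=> x x1; rewrite !E_out ?normrN // e_anti.
  apply: continuous_comp_fun E_cont.
  have c1 : continuous (fun x : 'rV[R]_n => x) by move=> x; exact: cvg_id.
  have c2 : continuous (fun _ : 'rV[R]_n => 0 : R) by exact: cst_continuous.
  by move=> x; exact: (cvg_pair (c1 x) (c2 x)).
- by move=> x x1; rewrite E_out // x1.
- split.
    apply: continuous_comp_fun E_cont.
    have c2 : continuous (fun y : 'rV[R]_n.+1 => (1 - y ord0 ord0) / 2).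
      apply: continuous_mulr; last exact: cst_continuous.
      by apply: continuous_subr; [exact: cst_continuous|exact: coord_continuous].
    by move=> y; exact: (cvg_pair (@rV_tail_continuous _ _ y) (c2 y)).
  move=> y /rV_norm_cons_ge1[y1|y1|y1]; rewrite rV_tailN !mxE.
  + rewrite E1; last by lra.
    by rewrite opprK [in RHS]E0 //; lra.
  + rewrite E0; last by lra.
    by rewrite [in RHS]E1 ?T_inv //; lra.
  + by rewrite !E_out ?normrN // e_anti.
- by move=> x; rewrite rV_cons_head rV_cons_tail subrr mul0r.
- by move=> x t x1; rewrite rV_cons_tail !E_out ?x1.
Qed.

End Step.

End Extension.

(** * Labels of tuples with disjoint supports *)

Section Labels.
Variables (R : realType) (V : finType) (sigma : {set V}) (q : nat).
Implicit Types z : V -> 'I_q -> R.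

Definition position z :=
  (forall v, v \in sigma -> (forall w, 0 <= z v w) /\ \sum_w z v w = 1) /\
  (forall u v, u \in sigma -> v \in sigma -> u != v ->
     forall w, z u w = 0 \/ z v w = 0).

Definition near_position (eps : R) z z' :=
  forall v w, v \in sigma -> `|z v w - z' v w| <= eps.

Definition peak z v : R := \big[Num.max/0]_w z v w.

Definition gap z v w : R := peak z v - z v w.

Definition superlevel z (t : R) : {set V * 'I_q} :=
  [set p | (p.1 \in sigma) && (gap z p.1 p.2 <= t)]%SET.

Definition level_count := (#|V| * q)%N.

Definition step : R := (q%:R * level_count.+2%:R)^-1.

(* No gap lies in ]j * step, (j + 1) * step], so the superlevel set at        *)
(* [step *+ j] only grows under a perturbation of [z]. There are more levels  *)
(* than gaps, hence such a [j] exists, and the levels stay below 1 / q, a     *)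
(* lower bound of every peak, so that the cell is contained in the support.   *)
Definition empty_level z (j : nat) :=
  superlevel z (step *+ j.+1) \subset superlevel z (step *+ j).

Definition level z : nat :=
  oapp (@nat_of_ord _) 0%N [pick j : 'I_level_count.+1 | empty_level z j].

Definition cell z := superlevel z (step *+ level z).

(** The sign says that min A_a < min A_b; the subtraction is exact by [card_cell]. *)
Definition position_label (a b : V) z : label :=
  ([exists w, ((a, w) \in cell z) && [forall w', ((b, w') \in cell z) ==> (w < w')%N]],
   (#|cell z| - #|sigma|)%N).

Lemma step_gt0 : (0 < q)%N -> 0 < step.
Proof. by move=> q0; rewrite invr_gt0 mulr_gt0 ?ltr0n. Qed.

Lemma step_ge0 : 0 <= step.
Proof. by rewrite invr_ge0 mulr_ge0. Qed.

Lemma peak_ge z v w : z v w <= peak z v.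
Proof. exact: le_bigmax. Qed.

Lemma peak_near eps z z' v : 0 <= eps -> v \in sigma ->
  (forall w, 0 <= z v w) -> (forall w, 0 <= z' v w) ->
  near_position eps z z' -> peak z v <= peak z' v + eps.
Proof.
move=> e0 vs z0 z0' zz; apply: bigmax_le => [|w _].
  by rewrite addr_ge0 // /peak; apply: le_trans (bigmax_ge_id _ _ _ _).
by have := zz v w vs; rewrite ler_norml; have := peak_ge z' v w; lra.
Qed.

Lemma near_positionC eps z z' : near_position eps z z' -> near_position eps z' z.
Proof. by move=> h v w vs; rewrite distrC h. Qed.

Lemma gap_near eps z z' v w : 0 <= eps -> position z -> position z' ->
  near_position eps z z' -> v \in sigma -> gap z v w <= gap z' v w + 2 * eps.
Proof.
move=> e0 [pz _] [pz' _] zz vs.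
have := peak_near e0 vs (pz v vs).1 (pz' v vs).1 zz.
by have := zz v w vs; rewrite ler_norml /gap; lra.
Qed.

Lemma superlevel_sub z s t : s <= t -> superlevel z s \subset superlevel z t.
Proof.
move=> st; apply/fintype.subsetP => p; rewrite !inE => /andP[-> h] /=; exact: le_trans st.
Qed.

Lemma level_empty z : empty_level z (level z).
Proof.
rewrite /level; case: pickP => [j //|h]; exfalso.
have : forall j, (j <= level_count.+1)%N -> (j <= #|superlevel z (step *+ j)|)%N.
  elim=> // j IH jC; apply: leq_ltn_trans (IH (ltnW jC)) _.
  apply: proper_card; rewrite properE superlevel_sub /=; last first.
    by apply: ler_wpMn2l; rewrite ?step_ge0.
  by have := h (Ordinal jC); rewrite /empty_level /= => ->.
move=> /(_ _ (leqnn _)) /leq_trans /(_ (max_card _)).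
by rewrite card_prod card_ord ltnn.
Qed.

Lemma level_lt z : (level z <= level_count)%N.
Proof. by rewrite /level; case: pickP => //= j _; rewrite -ltnS. Qed.

Section Position.
Variable z : V -> 'I_q -> R.
Hypothesis z_pos : position z.

Lemma position_dim_gt0 v : v \in sigma -> (0 < q)%N.
Proof.
move=> vs; case: (posnP q) => // q0; have [_] := z_pos.1 v vs.
rewrite big1 => [/esym/eqP|w]; first by rewrite oner_eq0.
by exfalso; have := ltn_ord w; move: (w : nat) => k; rewrite q0.
Qed.

Lemma cell_gt0 v w : (v, w) \in cell z -> 0 < z v w.
Proof.
rewrite inE /= => /andP[vs]; have q0 := position_dim_gt0 vs.
have [z0 z1] := z_pos.1 v vs.
have : 1 <= q%:R * peak z v.
  rewrite -[X in X <= _]z1; apply: (@le_trans _ _ (\sum_(w < q) peak z v)).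
    by apply: ler_sum => i _; apply: peak_ge.
  by rewrite mulr_natl sumr_const card_ord.
have : q%:R * (step *+ level z) < 1.
  rewrite -[step *+ _]mulr_natr /step invfM mulrA mulrA mulfV ?pnatr_eq0 -?lt0n // mul1r.
  by rewrite mulrC ltr_pdivrMr ?ltr0n // mul1r ltr_nat ltnS ltnW // ltnS level_lt.
rewrite /gap => h1 h2 h3.
have : q%:R * (step *+ level z) < q%:R * peak z v by lra.
by rewrite ltr_pM2l ?ltr0n //; lra.
Qed.

Lemma cell_inhabited v : v \in sigma -> exists w, (v, w) \in cell z.
Proof.
move=> vs; have q0 := position_dim_gt0 vs.
have [w _ pw] : exists2 w : 'I_q, true & peak z v = z v w.
  have [z0 _] := z_pos.1 v vs.
  have [w _ ew] := @eq_bigmax _ R _ 0 (Ordinal q0) xpredT (z v) isT (fun i _ => z0 i).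
  by exists w.
exists w; rewrite inE /= vs /gap pw subrr mulrn_wge0 //; exact: step_ge0.
Qed.

Lemma cell_disjoint u v w : (u, w) \in cell z -> (v, w) \in cell z -> u = v.
Proof.
move=> uw vw; apply/eqP; apply/negPn/negP => uv.
have us : u \in sigma by move: uw; rewrite inE => /andP[].
have vs : v \in sigma by move: vw; rewrite inE => /andP[].
have := cell_gt0 uw; have := cell_gt0 vw.
by case: (z_pos.2 _ _ us vs uv w) => ->; rewrite ltxx.
Qed.

(** The cell projects onto [sigma], and injectively to the colours because supports are disjoint. *)
Lemma card_cell : (#|sigma| <= #|cell z| <= q)%N.
Proof.
apply/andP; split.
  have -> : sigma = [set p.1 | p in cell z]%SET; last exact: leq_imset_card.
  apply/setP => v; apply/idP/imsetP => [/cell_inhabited[w vw]|[[u w]]]; first by exists (v, w).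
  by rewrite inE /= => /andP[us _] ->.
rewrite -[leqRHS]card_ord -(card_in_imset (f := @snd V 'I_q)) ?max_card //.
by move=> [u w] [v w'] uw vw /= ww; move: vw; rewrite -ww => vw; rewrite (cell_disjoint uw vw).
Qed.

End Position.

(** Gaps change by at most [step], so by [level_empty] the cell of lower level lies in the other
    one. Equal axes then force equal cells, hence equal signs. *)
Lemma position_label_near a b z z' : position z -> position z' ->
  near_position (step / 2) z z' ->
  position_label a b z <> opp_label (position_label a b z').
Proof.
move=> pz pz' zz; rewrite /opp_label /= => -[].
have sub z1 z2 : position z1 -> position z2 -> near_position (step / 2) z1 z2 ->
    (level z1 <= level z2)%N -> cell z1 \subset cell z2.
  move=> p1 p2 z12 l12; apply: fintype.subset_trans (level_empty z2).
  apply/fintype.subsetP => -[v w]; rewrite !inE /= => /andP[vs h]; rewrite vs /=.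
  have e0 : 0 <= step / 2 by rewrite divr_ge0 ?step_ge0.
  have := gap_near w e0 p2 p1 (near_positionC z12) vs.
  have : step *+ level z1 <= step *+ level z2 by apply: ler_wpMn2l; rewrite ?step_ge0.
  by rewrite [step *+ (level z2).+1]mulrS; lra.
move=> sg /eqP; have /andP[c1 _] := card_cell pz; have /andP[c2 _] := card_cell pz'.
rewrite -(eqn_add2r #|sigma|) !subnK // => /eqP cc.
have e : cell z = cell z'.
  have [l12|/ltnW l12] := leqP (level z) (level z').
    by apply/eqP; rewrite eqEcard sub //= cc.
  by apply/esym/eqP; rewrite eqEcard sub ?cc //=; apply: near_positionC.
by move: sg; rewrite e; case: [exists w, _].
Qed.

Section Reindex.
Variables (omega : {perm V}) (z z' : V -> 'I_q -> R).
Hypotheses (omega_inv : (omega @: sigma)%SET = sigma).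
Hypothesis zz' : forall v w, v \in sigma -> z' v w = z (omega v) w.

Lemma reindex_mem v : (omega v \in sigma) = (v \in sigma).
Proof.
by rewrite -{1}omega_inv mem_imset //; apply: perm_inj.
Qed.

Lemma superlevel_reindex t p :
  (p \in superlevel z' t) = ((omega p.1, p.2) \in superlevel z t).
Proof.
rewrite !inE /= reindex_mem; case vs : (p.1 \in sigma) => //=.
rewrite /gap zz' //; congr (_ - _ <= _); apply: eq_bigr => w _.
by rewrite zz'.
Qed.

Lemma superlevel_reindex_imset t :
  superlevel z t = [set (omega p.1, p.2) | p in superlevel z' t]%SET.
Proof.
apply/setP => -[v w]; apply/idP/imsetP => [h|[[u w']]]; last first.
  by rewrite superlevel_reindex /= => h [-> ->].
by exists ((omega^-1)%g v, w); rewrite ?superlevel_reindex /= permKV.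
Qed.

Lemma level_reindex : level z' = level z.
Proof.
rewrite /level; congr oapp; apply: eq_pick => j; rewrite /empty_level.
apply/fintype.subsetP/fintype.subsetP => h [v w].
  have := h ((omega^-1)%g v, w); rewrite !superlevel_reindex /= permKV; exact.
by rewrite !superlevel_reindex; apply: h.
Qed.

Lemma cell_reindex v w : ((v, w) \in cell z') = ((omega v, w) \in cell z).
Proof. by rewrite /cell level_reindex superlevel_reindex. Qed.

Lemma card_cell_reindex : #|cell z'| = #|cell z|.
Proof.
rewrite /cell level_reindex [in RHS]superlevel_reindex_imset card_imset //.
by move=> [u w] [v w'] /= [/perm_inj -> ->].
Qed.

End Reindex.

(** The cells of the two vertices are exchanged, and their minima differ by disjointness. *)
Lemma position_label_swap (omega : {perm V}) a z z' : position z ->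
  involutive omega -> (omega @: sigma)%SET = sigma -> a \in sigma -> omega a != a ->
  (forall v w, v \in sigma -> z' v w = z (omega v) w) ->
  position_label a (omega a) z' = opp_label (position_label a (omega a) z).
Proof.
move=> pz oK oI aS ab zz'; rewrite /position_label /opp_label /=.
rewrite (card_cell_reindex oI zz'); congr (_, _).
have bS : omega a \in sigma by rewrite (reindex_mem oI).
have minc v : v \in sigma -> exists2 w, (v, w) \in cell z &
    forall w', (v, w') \in cell z -> (w <= w')%N.
  move=> /(cell_inhabited pz)[w0 w0P].
  by case: (@arg_minnP _ w0 (fun w => (v, w) \in cell z) (@nat_of_ord q) w0P)
    => w wP wmin; exists w.
have [wa waP wa_min] := minc _ aS; have [wb wbP wb_min] := minc _ bS.
have -> : [exists w, ((a, w) \in cell z) &&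
    [forall w', ((omega a, w') \in cell z) ==> (w < w')%N]] = (wa < wb)%N.
  apply/existsP/idP => [[w /andP[h /forallP/(_ wb)]]|wab].
    rewrite wbP /=; apply: leq_ltn_trans; exact: wa_min.
  exists wa; rewrite waP; apply/forallP => w; apply/implyP => /wb_min; exact: leq_trans.
have -> : [exists w, ((a, w) \in cell z') &&
    [forall w', ((omega a, w') \in cell z') ==> (w < w')%N]] = (wb < wa)%N.
  apply/existsP/idP => [[w /andP[h /forallP/(_ wa)]]|wab].
    rewrite (cell_reindex oI zz') oK waP /=; apply: leq_ltn_trans; apply: wb_min.
    by rewrite -(cell_reindex oI zz').
  exists wb; rewrite (cell_reindex oI zz') wbP; apply/forallP => w; apply/implyP.
  by rewrite (cell_reindex oI zz') oK => /wa_min; exact: leq_trans.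
rewrite -leqNgt [RHS]leq_eqVlt; case: (eqVneq wb wa) => [e|ne]; last first.
  by rewrite (inj_eq (@ord_inj q)) (negbTE ne).
by move: waP; rewrite -e => /(cell_disjoint pz wbP)/eqP; rewrite (negbTE ab).
Qed.

Lemma eq_position_label a b z z' : a \in sigma -> b \in sigma ->
  (forall v w, v \in sigma -> z' v w = z v w) ->
  position_label a b z' = position_label a b z.
Proof.
move=> aS bS zz'; have o1 : ((1 : {perm V})%g @: sigma)%SET = sigma.
  by rewrite -[RHS]imset_id; apply: eq_imset => v; rewrite perm1.
have z1 v w : v \in sigma -> z' v w = z ((1 : {perm V})%g v) w by rewrite perm1; apply: zz'.
have e : cell z' = cell z.
  by apply/setP => -[v w]; rewrite (cell_reindex o1 z1) perm1.
by rewrite /position_label e.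
Qed.

End Labels.

(** * Equivariant spheres of odd degree *)

Section GridPoints.
Variables (R : realType).

Definition grid_point N n (p : seq nat) : 'rV[R]_n :=
  \row_i ((nth 0%N p i)%:R * 2 / N%:R - 1).

Lemma grid_point_cons N n t p :
  grid_point N n.+1 (t :: p) = rV_cons (t%:R * 2 / N%:R - 1) (grid_point N n p).
Proof.
by apply/rowP => j; rewrite !mxE; case: (unliftP ord0 j) => [i|] -> //=; rewrite mxE.
Qed.

Lemma grid_coord_bounds N (k : nat) : (0 < N)%N -> (k <= N)%N ->
  -1 <= (k%:R * 2 / N%:R - 1 : R) <= 1.
Proof.
move=> N0 kN; have : 0 <= (k%:R / N%:R : R) <= 1.
  by rewrite divr_ge0 //= ler_pdivrMr ?ltr0n // mul1r ler_nat.
lra.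
Qed.

Lemma grid_point_norm N n p : (0 < N)%N -> grid N n p -> `|grid_point N n p| <= 1.
Proof.
move=> N0 /andP[/eqP sp /allP pN]; apply: rV_norm_le => // i.
rewrite mxE ler_norml; apply: grid_coord_bounds => //.
by apply: pN; rewrite mem_nth ?sp.
Qed.

Lemma grid_point_boundary N n p : (0 < N)%N -> boundary N n p ->
  `|grid_point N n p| = 1.
Proof.
move=> N0 /andP[pg /hasP[k kp k01]]; apply/eqP; rewrite eq_le grid_point_norm //=.
have /andP[/eqP sp _] := pg.
have ki : (index k p < n)%N by rewrite -sp index_mem.
have := rV_coord_le (grid_point N n p) (Ordinal ki); rewrite mxE /= nth_index //.
apply: le_trans; case/orP: k01 => /eqP ->; rewrite ler_normr; apply/orP.
  by right; rewrite !mul0r; lra.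
by left; rewrite mulrAC divff ?pnatr_eq0 -?lt0n //; lra.
Qed.

Lemma grid_point_refl N n p : (0 < N)%N -> grid N n p ->
  grid_point N n (refl N p) = - grid_point N n p.
Proof.
move=> N0 /andP[/eqP sp /allP pN]; apply/rowP => i; rewrite !mxE.
rewrite (nth_map 0%N) ?sp // natrB; last by apply: pN; rewrite mem_nth ?sp.
have : N%:R / N%:R = 1 :> R by rewrite divff // pnatr_eq0 -lt0n.
by move: (N%:R : R) (_%:R : R) => a b h; rewrite mulrAC mulrBl h; lra.
Qed.

Lemma grid_point_cube N n l p p' : (0 < N)%N -> in_cube N n l -> p \in l -> p' \in l ->
  `|grid_point N n p - grid_point N n p'| <= 2 / N%:R.
Proof.
move=> N0 [_ [b lb]] pl pl'; apply: rV_norm_le => [|i]; first by rewrite divr_ge0.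
rewrite !mxE; have := lb _ _ pl (ltn_ord i); have := lb _ _ pl' (ltn_ord i).
move: (nth 0%N p i) (nth 0%N p' i) (nth 0%N b i) => x y z /andP[h1 h2] /andP[h3 h4].
have : `|x%:R - y%:R| <= 1 :> R.
  rewrite ler_distl; apply/andP; split.
    by rewrite lerBlDr natr1 ler_nat; lia.
  by rewrite natr1 ler_nat; lia.
have -> : x%:R * 2 / N%:R - 1 - (y%:R * 2 / N%:R - 1) = (x%:R - y%:R) * (2 / N%:R) :> R.
  by ring.
rewrite normrM (ger0_norm (x := 2 / _)) ?divr_ge0 // => h.
by rewrite ler_piMl ?divr_ge0.
Qed.

(** The filter in [d] lets finitely many functions share one [d] in [fine_mesh]. *)
Lemma uniform_continuity_ball n (f : 'rV[R]_n -> R) (eps : R) :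
  continuous f -> 0 < eps ->
  \forall d \near at_right (0 : R), forall x y, `|x| <= 1 -> `|x - y| <= d -> `|f x - f y| <= eps.
Proof.
move=> cf e0.
have cball : compact [set x : 'rV[R]_n | `|x| <= 1]%classic.
  apply: bounded_closed_compact.
    by exists 1; split => // M M1 x /= x1; apply: le_trans x1 (ltW M1).
  apply: (@closed_comp _ _ (fun x : 'rV[R]_n => `|x|) [set r | r <= 1]%classic).
    by move=> x _; exact: norm_continuous.
  exact: closed_le.
have /compact_near_coveringP h := cball.
pose P (d : R) (x : 'rV[R]_n) := forall y, `|x - y| <= d -> `|f x - f y| <= eps.
suff cov : forall x : 'rV[R]_n, `|x| <= 1 ->
    \forall x' \near x & d \near at_right (0 : R), P d x'.
  have := h R _ P (at_right_proper_filter (0 : R)) cov.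
  by apply: filterS => d dP x y x1; exact: dP.
move=> x x1; have /nbhs_ballP[r r0 rP] : nbhs x [set y | `|f x - f y| < eps / 2]%classic.
  have := cf x; move=> /cvgrPdist_lt; apply; lra.
have {}r0 : 0 < r by [].
near=> x' d => y yd.
have xx' : `|x - x'| < r / 2.
  by near: x'; apply/nbhs_ballP; exists (r / 2); rewrite /= ?divr_gt0 // => z; rewrite -ball_normE.
have dr : d < r / 2 by near: d; apply: nbhs_right_lt; rewrite divr_gt0.
have h1 : `|f x - f x'| < eps / 2.
  by apply: rP; rewrite -ball_normE /=; apply: lt_trans xx' _; lra.
have h2 : `|f x - f y| < eps / 2.
  apply: rP; rewrite -ball_normE /=; apply: le_lt_trans (ler_distD x' x y) _.
  by rewrite (splitr r) ltrD //; apply: le_lt_trans yd dr.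
by have := ler_distD (f x) (f x') (f y); rewrite (distrC (f x') (f x)); lra.
Unshelve. all: by end_near.
Qed.

End GridPoints.

Section Tower.
Variables (R : realType) (X : topologicalType) (T : X -> X).
Hypotheses (T_cont : continuous T) (T_inv : involutive T).
(** [X] carries no metric; closeness is measured by the finitely many functions [F]. *)
Variables (I : finType) (F : X -> I -> R) (axes : seq nat) (lam : X -> label) (eps : R).
Hypotheses (F_cont : forall i, continuous (fun x => F x i)) (uniq_axes : uniq axes).
Hypotheses (lam_axes : forall x, (lam x).2 \in axes) (eps_gt0 : 0 < eps).
Hypothesis lam_near : forall x y,
  (forall i, `|F x i - F y i| <= eps) -> lam x <> opp_label (lam y).
Hypothesis lam_T : forall x, lam (T x) = opp_label (lam x).

Lemma fine_mesh n (e : 'rV[R]_n -> X) (r : R) : continuous e -> 0 < r ->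
  exists N0, forall N, (N0 < N)%N -> forall l p p', in_cube N n l -> p \in l -> p' \in l ->
    forall i, `|F (e (grid_point R N n p)) i - F (e (grid_point R N n p')) i| <= r.
Proof.
move=> ce r0.
have : \forall d \near at_right (0 : R), forall i x y, `|x| <= 1 -> `|x - y| <= d ->
    `|F (e x) i - F (e y) i| <= r.
  apply: filter_forall => i; apply: (@uniform_continuity_ball R n (fun x => F (e x) i)) => //.
  exact: continuous_comp_fun ce (@F_cont i).
move=> dP; have [d [d0 {}dP]] := filter_ex (filterI (nbhs_right_gt 0) dP).
exists (Num.bound (2 / d)) => N NN l p p' lc pl pl' i.
have N0 : (0 < N)%N by apply: leq_ltn_trans NN.
apply: dP; first exact: grid_point_norm N0 (in_cube_grid lc pl).
apply: le_trans (grid_point_cube R N0 lc pl pl') _.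
rewrite ler_pdivrMr ?ltr0n // mulrC -ler_pdivrMr //.
apply/ltW/(lt_trans (archi_boundP _)); first by rewrite divr_ge0 // ltW.
by rewrite ltr_nat.
Qed.

Lemma labelling_grid n (e : 'rV[R]_n -> X) : continuous e ->
  exists N0, forall N, (N0 < N)%N -> labelling N axes n (fun p => lam (e (grid_point R N n p))).
Proof.
move=> ce; have [N0 h] := fine_mesh ce eps_gt0; exists N0 => N NN0; split; last first.
  by move=> p _; apply: lam_axes.
move=> l lc; apply/allP => _ /mapP[p pl ->]; apply/mapP => -[p' pl' /esym].
exact: lam_near (h N NN0 l p' p lc pl' pl).
Qed.

Definition odd_degree n (e : 'rV[R]_n -> X) := exists N0, forall N, (N0 < N)%N ->
  odd `|(degree N axes true n (fun p => lam (e (grid_point R N n p))) +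
         degree N axes false n (fun p => lam (e (grid_point R N n p))))%R|%N.

(** All [a] with the equator of [e] are allowed since [extend_antipodal] replaces [e] by such a map
    before using it as the two hemispheres of the next equator. *)
Lemma equivariant_sphere n (x0 : X) :
  (forall i x, (i < n)%N -> @pi_vanishes R X i x) ->
  exists e : 'rV[R]_n -> X, [/\ continuous e, antipodal T e &
    forall a : 'rV[R]_n -> X, continuous a -> antipodal T a ->
      (forall x, `|x| = 1 -> a x = e x) -> odd_degree a].
Proof.
elim: n => [|n IH] pi_n.
  exists (fun=> x0); split; first exact: cst_continuous.
    by move=> x; rewrite [x]thinmx0 normr0 ler10.
  by move=> a _ _ _; exists 0%N => N _; rewrite degree_dim0.
have [|e [ce ae odd_e]] := IH; first by move=> i x ni; apply: pi_n; rewrite ltnW.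
have [a [e' [[ca aa] a_e [ce' ae'] e'top e'side]]] :=
  extend_antipodal T_cont T_inv ce ae (fun x => pi_n n x (leqnn _)).
exists e'; split=> // b cb ab b_e'.
have [N1 h1] := odd_e a ca aa a_e; have [N2 h2] := labelling_grid cb.
exists (maxn N1 N2) => N; rewrite gtn_max => /andP[NN1 NN2].
have N0 : (0 < N)%N by apply: leq_ltn_trans NN1.
have gp1 p (t : R) : grid N n p -> -1 <= t <= 1 -> `|t| = 1 \/ boundary N n p ->
    `|rV_cons t (grid_point R N n p)| = 1.
  move=> pg t1 tp; apply/eqP; rewrite eq_le; apply/andP; split.
    apply: rV_norm_le => // i; rewrite mxE; case: (unlift ord0 i) => [j|] /=.
      by apply: le_trans (rV_coord_le _ _) (grid_point_norm _ N0 pg).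
    by rewrite ler_norml.
  case: tp => [<-|/(grid_point_boundary R N0) <-].
    by have := rV_coord_le (rV_cons t (grid_point R N n p)) ord0; rewrite rV_cons_head.
  apply: rV_norm_le => // i.
  have := rV_coord_le (rV_cons t (grid_point R N n p)) (lift ord0 i).
  by rewrite [X in `|X| <= _]mxE liftK.
have NN : N%:R * 2 / N%:R - 1 = 1 :> R.
  by rewrite mulrAC divff ?pnatr_eq0 -?lt0n //; lra.
apply: (degree_fan uniq_axes (h2 N NN2) _ _ _ (h1 N NN1)) => p.
- move=> pg; rewrite grid_point_cons NN b_e'; last by apply: gp1 => //; [lra|left; rewrite normr1].
  by rewrite e'top.
- move=> pg; rewrite grid_point_cons !mul0r sub0r -lam_T; congr lam.
  rewrite -[grid_point R N n p]opprK -rV_consN -grid_point_refl //.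
  have n1 : `|rV_cons 1 (grid_point R N n (refl N p))| = 1.
    by apply: gp1 (grid_refl pg) _ _; [lra|left; rewrite normr1].
  by rewrite ab ?n1 // b_e' // e'top.
- move=> t pb tN; rewrite grid_point_cons b_e'; last first.
    by apply: gp1; [case/andP: pb|apply: grid_coord_bounds|right].
  by rewrite e'side // grid_point_boundary.
Qed.

End Tower.

(** * Projectivities acting on the Hom complex *)

Section Edges.
Variables (V : finType) (G : scomplex V).

Definition edge (u v : V) := u != v /\ [set u; v]%SET \in G.

Lemma edge_sym u v : edge u v -> edge v u.
Proof. by rewrite /edge eq_sym finset.setUC. Qed.

Lemma face_edge (s : {set V}) u v : s \in G -> u \in s -> v \in s -> u != v -> edge u v.
Proof.
move=> sG us vs uv; split=> //; apply: faces_sub sG _ _.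
  by apply/fintype.subsetP => x; rewrite !inE => /orP[] /eqP ->.
by apply/finset.set0Pn; exists u; rewrite !inE eqxx.
Qed.

Variable d : nat.

Section Perspectivity.
Variables s t : {set V}.
Hypothesis st : ridge_adjacent G d s t.

Lemma perspectivity_in v : v \in s -> perspectivity s t v \in t.
Proof.
move=> vs; rewrite /perspectivity; case: ifP => // vt.
case: pickP => [w|no]; first by rewrite inE => /andP[].
have /and5P[_ _ /eqP cs /eqP ct _] := st; exfalso.
have ts : t \subset s by rewrite -finset.setD_eq0; apply/eqP/setP => w; rewrite no inE.
have : t == s by rewrite eqEcard ts cs ct leqnn.
by move=> /eqP e; move: vt; rewrite e vs.
Qed.

Lemma perspectivity_new v : v \in s -> v \notin t -> perspectivity s t v \notin s.
Proof.
move=> vs vt; have := perspectivity_in vs; rewrite /perspectivity (negbTE vt).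
by case: pickP => [w|_ /=]; [rewrite inE => /andP[]|rewrite (negbTE vt)].
Qed.

(** Two vertices of [s] outside [t] would leave at most d-1 common ones. *)
Lemma ridge_fixed u v : u \in s -> v \in s -> u != v -> u \notin t -> v \in t.
Proof.
move=> us vs uv ut; apply/negPn/negP => vt.
have /and5P[_ _ /eqP cs _ ds] := st.
have : (#|s :&: t| < d)%N; last by rewrite ltnNge ds.
have : [set u; v]%SET \subset s :\: t.
  by apply/fintype.subsetP => x; rewrite !inE => /orP[] /eqP ->; apply/andP; split.
move=> /subset_leq_card; rewrite cards2 uv.
by have := cardsID t s; rewrite cs; lia.
Qed.

(** At most one vertex moves, so each of the three pairs lies in [s] or in [t]. *)
Lemma perspectivity_edges u v : u \in s -> v \in s -> u != v ->
  [/\ edge u v, edge u (perspectivity s t v) & edge (perspectivity s t u) (perspectivity s t v)].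
Proof.
have /and5P[sG tG _ _ _] := st => us vs uv.
have pE x : x \in t -> perspectivity s t x = x by rewrite /perspectivity => ->.
have e1 x y : x \in s -> y \in s -> x != y -> edge x (perspectivity s t y).
  move=> xs ys xy; case: (boolP (y \in t)) => yt.
    by rewrite pE //; exact: face_edge sG _ _ xy.
  have xt : x \in t by apply: ridge_fixed ys xs _ yt; rewrite eq_sym.
  apply: face_edge tG xt (perspectivity_in ys) _.
  by apply: contraNneq (perspectivity_new ys yt) => <-.
split; [exact: face_edge sG _ _ uv|exact: e1|].
case: (boolP (u \in t)) => ut; first by rewrite [perspectivity s t u]pE //; exact: e1.
rewrite [perspectivity s t v]pE; last exact: ridge_fixed us vs uv ut.
by apply: edge_sym; apply: e1; rewrite // eq_sym.
Qed.

End Perspectivity.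
End Edges.

Lemma continuous_bigsum (R : realType) (Y : topologicalType) (I : Type) (r : seq I)
    (P : pred I) (f : I -> Y -> R) :
  (forall i, continuous (f i)) -> continuous (fun y => \sum_(i <- r | P i) f i y).
Proof.
move=> cf; elim: r => [|i r IH].
  by under eq_fun do rewrite big_nil; exact: cst_continuous.
under eq_fun do rewrite big_cons.
by case: (P i) => //; apply: continuous_addr.
Qed.

Lemma continuous_prod (Y : topologicalType) (I : eqType) (Z : I -> topologicalType)
    (f : Y -> prod_topology Z) :
  (forall i, continuous (fun y => f y i)) -> continuous f.
Proof.
move=> cf x; apply/cvg_sup => i; move: x.
exact: (@continuous_comp_initial _ _ _ (fun g : forall i, Z i => g i) f (cf i)).
Qed.

Section HomPoints.
Variables (R : realType) (V W : finType) (G : scomplex V) (K : scomplex W).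
Notation X := (hom_complex R G K).

Definition coord (x : X) (v : V) (w : W) : R := (\val x : V -> W -> R) v w.

Lemma coord_cell (x : X) : exists2 eta, hom_index G K eta & hom_cell eta (\val x).
Proof. by have := set_valP x => -[eta]; exists eta. Qed.

Lemma coord_ge0 x v w : 0 <= coord x v w.
Proof. by have [eta _ /(_ v)[]] := coord_cell x. Qed.

Lemma coord_sum x v : \sum_w coord x v w = 1.
Proof. by have [eta _ /(_ v)[]] := coord_cell x. Qed.

(** The first condition on [eta] separates w from w', the second joins them. *)
Lemma coord_edge x u v w w' : edge G u v -> coord x u w != 0 -> coord x v w' != 0 ->
  edge K w w'.
Proof.
move=> [uv uvG]; have [eta [_ e2 e3] ce] := coord_cell x => uw vw.
have wu : w \in eta u.
  by apply: contraNT uw => wu; apply/eqP; have [_ _] := ce u; exact.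
have wv : w' \in eta v.
  by apply: contraNT vw => wv; apply/eqP; have [_ _] := ce v; exact.
have ww : w != w'.
  apply/negP => /eqP e; have := e2 _ _ uv uvG; move/setP/(_ w).
  by rewrite !inE wu e wv.
split=> //; have := e3 _ uvG (fun y => if y == u then w else w').
have -> : ((fun y => if y == u then w else w') @: [set u; v] = [set w; w'])%SET.
  by rewrite imsetU1 imset_set1 eqxx eq_sym (negbTE uv).
by apply=> y; rewrite !inE => /orP[] /eqP ->; rewrite ?eqxx // eq_sym (negbTE uv).
Qed.

Lemma coord_continuous_hom v w : continuous (fun x : X => coord x v w).
Proof.
have c1 : continuous (fun x : X => \val x) by exact: initial_continuous.
have c2 : continuous (fun f : {ptws V -> {ptws W -> R}} => f v).
  exact: (@proj_continuous V (fun=> {ptws W -> R}) v).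
have c3 : continuous (fun f : {ptws W -> R} => f w).
  exact: (@proj_continuous W (fun=> R) w).
exact: continuous_comp_fun (continuous_comp_fun c1 c2) c3.
Qed.

Variable omega : {perm V}.
Hypothesis omega_simplicial : simplicial G G omega.

Lemma hom_index_perm eta : hom_index G K eta -> hom_index G K (fun v => eta (omega v)).
Proof.
move=> [e1 e2 e3]; split=> [v|u v uv uvG|s sG f fs]; first exact: e1.
  apply: e2; first by rewrite (inj_eq perm_inj).
  by have := omega_simplicial uvG; rewrite imsetU1 imset_set1.
have := e3 _ (omega_simplicial sG) (fun v => f ((omega^-1)%g v)).
have -> : ((fun v => f ((omega^-1)%g v)) @: (omega @: s) = f @: s)%SET.
  by rewrite -imset_comp; apply: eq_imset => v /=; rewrite permK.
by apply=> _ /imsetP[v vs ->]; rewrite permK; apply: fs.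
Qed.

Lemma precomp_subproof (x : X) :
  (fun v => \val x (omega v) : {ptws W -> R}) \in @hom_points R V W G K.
Proof.
have [eta ie ce] := coord_cell x; apply/mem_set.
by exists (fun v => eta (omega v)); [exact: hom_index_perm|move=> v; exact: ce].
Qed.

Definition precomp (x : X) : X :=
  exist (fun f => f \in @hom_points R V W G K) _ (precomp_subproof x).

Lemma precompK : involutive omega -> involutive precomp.
Proof.
move=> oK x; apply/val_inj/funext => v /=.
by rewrite oK.
Qed.

Lemma precomp_continuous : continuous precomp.
Proof.
have c1 : continuous (fun x : X => \val x) by exact: initial_continuous.
apply: continuous_comp_initial; apply: continuous_prod => v.
have c2 : continuous (fun f : {ptws V -> {ptws W -> R}} => f (omega v)).
  exact: (@proj_continuous V (fun=> {ptws W -> R}) (omega v)).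
exact: (continuous_comp_fun c1 c2).
Qed.

Variables (q : nat) (c : W -> 'I_q).
Hypothesis c_nondeg : Defs.nondegenerate K (full_simplex 'I_q) c.

Definition color (x : X) (v : V) (j : 'I_q) : R := \sum_(w | c w == j) coord x v w.

Lemma color_ge0 x v j : 0 <= color x v j.
Proof. by apply: sumr_ge0 => w _; apply: coord_ge0. Qed.

Lemma color_sum x v : \sum_j color x v j = 1.
Proof. by rewrite -(coord_sum x v) (partition_big c xpredT). Qed.

Lemma color_le1 x v j : color x v j <= 1.
Proof.
rewrite -(color_sum x v) (bigD1 j) //= lerDl.
by apply: sumr_ge0 => i _; apply: color_ge0.
Qed.

(** Otherwise [coord_edge] gives two adjacent vertices of [K] of colour [j]. *)
Lemma color_disjoint x u v j : edge G u v -> color x u j = 0 \/ color x v j = 0.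
Proof.
move=> uv; have [->|] := eqVneq (color x u j) 0; first by left.
have [->|] := eqVneq (color x v j) 0; first by right.
have nz (y : V) : color x y j != 0 -> exists2 w, c w = j & coord x y w != 0.
  move=> h; apply: contrapT => no; move/eqP: h; apply; apply: big1 => w /eqP cw.
  by apply/eqP/negPn/negP => nw; apply: no; exists w.
move=> /nz[w' cw' nw'] /nz[w cw nw].
have [ww wwK] := coord_edge uv nw nw'.
have := c_nondeg.2 _ wwK w w'; rewrite !inE !eqxx orbT cw cw' => /(_ isT isT erefl) e.
by rewrite e eqxx in ww.
Qed.

Lemma color_continuous v j : continuous (fun x => color x v j).
Proof.
apply: continuous_bigsum => w; exact: coord_continuous_hom.
Qed.

End HomPoints.

(** * Moving tuples along a chain of adjacent simplices *)

Section Stages.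
Variables (R : realType) (V W : finType) (G : scomplex V) (K : scomplex W).
Variables (omega : {perm V}) (sigma : {set V}) (a b : V) (q : nat) (c : W -> 'I_q).
Hypothesis omega_simplicial : simplicial G G omega.
Hypothesis c_nondeg : Defs.nondegenerate K (full_simplex 'I_q) c.
Hypothesis q_gt0 : (0 < q)%N.
Notation X := (hom_complex R G K).
Notation T := (@precomp R V W G K omega omega_simplicial).
Notation stepR := (step R V q).
Implicit Types g : V -> V.

Definition stage g (x : X) : V -> 'I_q -> R := fun v => color c x (g v).

Definition stage_label g (x : X) : label := position_label sigma a b (stage g x).

Definition interpolate (s : R) g g' (x : X) : V -> 'I_q -> R :=
  fun v j => (1 - s) * stage g x v j + s * stage g' x v j.

Definition linked g g' := forall u v, u \in sigma -> v \in sigma -> u != v ->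
  [/\ edge G (g u) (g v), edge G (g u) (g' v) & edge G (g' u) (g' v)].

(** The support at v lies in the union of those at g v and g' v; all four pairs arising from u and v
    are edges, the mixed ones by using [linked] in both orders. *)
Lemma interpolate_position s g g' x : linked g g' -> 0 <= s <= 1 ->
  position sigma (interpolate s g g' x).
Proof.
move=> gg s01; split.
  move=> v vs; split.
    move=> j; rewrite /interpolate /stage.
    by have := color_ge0 c x (g v) j; have := color_ge0 c x (g' v) j; nra.
  rewrite big_split -!mulr_sumr /= /stage !color_sum; lra.
move=> u v us vs uv j; rewrite /interpolate /stage.
have [e1 e2 e3] := gg u v us vs uv.
have [_ e4 _] : [/\ edge G (g v) (g u), edge G (g v) (g' u) & edge G (g' v) (g' u)].
  by apply: gg; rewrite // eq_sym.
have [h1|h1] := color_disjoint c_nondeg x j e1; last first.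
  have [h2|h2] := color_disjoint c_nondeg x j e3; last by right; rewrite h1 h2; lra.
  have [h3|h3] := color_disjoint c_nondeg x j e2; first by left; rewrite h3 h2; lra.
  by right; rewrite h1 h3; lra.
have [h2|h2] := color_disjoint c_nondeg x j e3; first by left; rewrite h1 h2; lra.
have [h3|h3] := color_disjoint c_nondeg x j (edge_sym e4); first by left; rewrite h1 h3; lra.
by right; rewrite h2 h3; lra.
Qed.

Lemma interpolate0 g g' x : interpolate 0 g g' x = stage g x.
Proof. by apply/funext => v; apply/funext => j; rewrite /interpolate; lra. Qed.

Lemma interpolate1 g g' x : interpolate 1 g g' x = stage g' x.
Proof. by apply/funext => v; apply/funext => j; rewrite /interpolate; lra. Qed.

Lemma interpolate_near s s' r g g' x x' :
  0 <= s <= 1 -> `|s - s'| <= r ->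
  (forall v j, `|color c x v j - color c x' v j| <= r) ->
  near_position sigma (2 * r) (interpolate s g g' x) (interpolate s' g g' x').
Proof.
move=> s01 ss xx v j _; rewrite /interpolate /stage.
have := xx (g v) j; have := xx (g' v) j.
have := color_ge0 c x' (g v) j; have := color_ge0 c x' (g' v) j.
have := color_le1 c x' (g v) j; have := color_le1 c x' (g' v) j.
move: (color c x (g v) j) (color c x' (g v) j) (color c x (g' v) j) (color c x' (g' v) j).
move=> A A' B B' B'1 A'1 B'0 A'0 BB AA.
have -> : (1 - s) * A + s * B - ((1 - s') * A' + s' * B') =
  ((1 - s) * (A - A') + s * (B - B')) + (s - s') * (B' - A') by ring.
apply: le_trans (ler_normD _ _) _; have -> : 2 * r = r + r by ring.
apply: lerD.
  have s0 : 0 <= s by lra.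
  have s1 : 0 <= 1 - s by lra.
  apply: le_trans (ler_normD _ _) _; rewrite !normrM (ger0_norm s0) (ger0_norm s1).
  by have := ler_wpM2l s0 BB; have := ler_wpM2l s1 AA; lra.
rewrite normrM -[leRHS]mulr1 ler_pM //.
by rewrite ler_norml; lra.
Qed.

Variables (n : nat) (e : 'rV[R]_n -> X).
Hypotheses (n_even : ~~ odd n) (q_le : (q <= n + #|sigma|)%N).
Hypotheses (e_cont : continuous e) (e_anti : antipodal T e).

Definition axes := iota 0 n.+1.

Lemma position_label_axes z : position sigma z -> (@position_label R V sigma q a b z).2 \in axes.
Proof.
move=> /card_cell/andP[c1 c2]; rewrite mem_iota /= add0n ltnS.
by rewrite leq_subLR addnC (leq_trans c2).
Qed.

Definition stage_degree s g (f : 'rV[R]_n -> X) N : int :=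
  degree N axes s n (fun p => stage_label g (f (grid_point R N n p))).

(** The head of a grid point is the time; [h] lets it run upwards or downwards. *)
Lemma interpolate_labelling g g' (f : 'rV[R]_n -> X) (h : nat -> nat -> nat) :
  linked g g' -> continuous f ->
  (forall N t, (t <= N)%N -> (h N t <= N)%N) ->
  (forall N t t', (t <= N)%N -> (t' <= N)%N -> (t' <= t <= t'.+1)%N ->
     (h N t <= (h N t').+1)%N /\ (h N t' <= (h N t).+1)%N) ->
  exists N0, forall N, (N0 < N)%N -> labelling N axes n.+1
   (fun p => position_label sigma a b
     (interpolate ((h N (head 0%N p))%:R / N%:R) g g' (f (grid_point R N n (behead p))))).
Proof.
move=> gg cf hN hS; have st0 := step_gt0 R V q_gt0.
(* [interpolate_near] doubles the error and [position_label_near] allows half a step. *)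
have r0 : 0 < stepR / 4 by rewrite divr_gt0.
have [N1 mesh] := fine_mesh (I := (V * 'I_q)%type) (F := fun x i => color c x i.1 i.2)
  (fun i => @color_continuous R V W G K q c i.1 i.2) cf r0.
exists (maxn N1 (Num.bound (4 / stepR))) => N; rewrite gtn_max => /andP[NN1 NN2].
have N0 : (0 < N)%N by apply: leq_ltn_trans NN1.
have s01 k : (k <= N)%N -> 0 <= (k%:R / N%:R : R) <= 1.
  by move=> kN; rewrite divr_ge0 //= ler_pdivrMr ?ltr0n // mul1r ler_nat.
have posN p : grid N n.+1 p -> position sigma (interpolate ((h N (head 0%N p))%:R / N%:R)
    g g' (f (grid_point R N n (behead p)))).
  move=> pg; apply: interpolate_position => //; apply: s01; apply: hN.
  by case: p pg => //= t p /andP[_ /andP[]].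
split=> [l lc|p /posN]; last exact: position_label_axes.
apply/allP => _ /mapP[p pl ->]; apply/mapP => -[p' pl' /esym].
have pg := in_cube_grid lc pl; have pg' := in_cube_grid lc pl'.
apply: (position_label_near (posN _ pg') (posN _ pg)).
have -> : stepR / 2 = 2 * (stepR / 4) by lra.
apply: interpolate_near.
- by apply: s01; apply: hN; case: p' pg' {pl'} => //= t p' /andP[_ /andP[]].
- have hh : `|(h N (head 0%N p'))%:R - (h N (head 0%N p))%:R| <= 1 :> R.
    have [_ [bb lb]] := lc.
    have := lb p 0%N pl isT; have := lb p' 0%N pl' isT; rewrite !nth0.
    have tN (r : seq nat) : grid N n.+1 r -> (head 0%N r <= N)%N.
      by case: r => //= t r /andP[_ /andP[]].
    have := tN p pg; have := tN p' pg'.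
    move: (head 0%N p) (head 0%N p') => x y yN xN /andP[b1 b2] /andP[b3 b4].
    have [h1 h2] : (h N x <= (h N y).+1)%N /\ (h N y <= (h N x).+1)%N.
      have [xy|xy] := leqP x y; last by apply: hS => //; lia.
      by apply/and_comm; apply: hS => //; lia.
    by rewrite ler_distl lerBlDr !natr1 !ler_nat h1 h2.
  rewrite -mulrBl normrM (ger0_norm (x := N%:R^-1)) ?invr_ge0 //.
  rewrite ler_pdivrMr ?ltr0n //; apply: le_trans hh _.
  have : 4 / stepR < N%:R.
    apply: lt_trans (archi_boundP _) _; first by rewrite divr_ge0 // ltW.
    by rewrite ltr_nat.
  by rewrite ltr_pdivrMr //; lra.
- move=> v j; apply: (mesh N NN1 (map behead l) _ _ _ _ _ (v, j)); try exact: map_f.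
  have [/allP lg [bb lb]] := lc; split.
    apply/allP => _ /mapP[r /lg rg ->]; case: r rg => //= t r /andP[/eqP[sr] /andP[_ ar]].
    by rewrite /grid sr eqxx.
  exists (behead bb) => _ i /mapP[r rl ->] ni; rewrite !nth_behead; exact: lb.
Qed.

(** Both hemispheres are moved by [interpolate], the second with time reversed. On the equator [T]
    after [e] is [e] at the antipode, which is the matching asked for by [degree_homotopy]. *)
Lemma stage_degree_link s g g' : linked g g' -> exists N0, forall N, (N0 < N)%N ->
  stage_degree s g' e N - stage_degree s g' (fun x => T (e x)) N =
  stage_degree s g e N - stage_degree s g (fun x => T (e x)) N.
Proof.
move=> gg.
have Te_cont : continuous (fun x => T (e x)).
  exact: continuous_comp_fun e_cont (@precomp_continuous R V W G K omega omega_simplicial).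
have [||N1 l1] := interpolate_labelling (h := fun _ t => t) gg e_cont.
- by [].
- by move=> N t t' _ _; lia.
have [||N2 l2] := interpolate_labelling (h := fun N t => N - t)%N gg Te_cont.
- by move=> N t _; apply: leq_subr.
- by move=> N t t'; lia.
exists (maxn N1 N2) => N; rewrite gtn_max => /andP[NN1 NN2].
have N0 : (0 < N)%N by apply: leq_ltn_trans NN1.
have NN : N%:R / N%:R = 1 :> R by rewrite divff // pnatr_eq0 -lt0n.
have := degree_homotopy (iota_uniq 0 n.+1) s n_even _ (l1 N NN1) (l2 N NN2) _.
rewrite /= subnn subn0 !mul0r NN.
have e0 f : (fun p => position_label sigma a b
    (interpolate 0 g g' (f (grid_point R N n p)))) =
    (fun p => stage_label g (f (grid_point R N n p))).
  by apply/funext => p; rewrite interpolate0.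
have e1 f : (fun p => position_label sigma a b
    (interpolate 1 g g' (f (grid_point R N n p)))) =
    (fun p => stage_label g' (f (grid_point R N n p))).
  by apply/funext => p; rewrite interpolate1.
rewrite (e0 e) (e1 e) (e0 (fun x => T (e x))) (e1 (fun x => T (e x))).
apply; first by rewrite size_iota.
move=> p t pb tN; rewrite grid_point_refl //; last by case/andP: pb.
by rewrite e_anti // grid_point_boundary.
Qed.

(** Induction on the chain; injectivity is kept because perspectivities send distinct vertices to
    the ends of an edge. *)
Lemma stage_degree_path d s g (t : {set V}) chain : {in sigma, forall v, g v \in t} ->
  {in sigma &, injective g} -> path (ridge_adjacent G d) t chain ->
  exists N0, forall N, (N0 < N)%N ->
  stage_degree s (fun v => transport t chain (g v)) e N -
  stage_degree s (fun v => transport t chain (g v)) (fun x => T (e x)) N =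
  stage_degree s g e N - stage_degree s g (fun x => T (e x)) N.
Proof.
elim: chain g t => [|t' chain IH] g t gt ginj /=; first by exists 0%N.
move=> /andP[tt' pc].
have link u v : u \in sigma -> v \in sigma -> u != v -> g u != g v.
  by move=> us vs; apply: contra => /eqP /ginj ->.
have [] := IH (fun v => perspectivity t t' (g v)) t' _ _ pc.
- move=> v vs /=; exact: (perspectivity_in tt' (gt v vs)).
- move=> u v us vs puv; apply/eqP/negPn/negP => uv.
  have [_ _ [/eqP]] := perspectivity_edges tt' (gt u us) (gt v vs) (link u v us vs uv).
  by rewrite puv.
move=> N1 h1; have [|N2 h2] := @stage_degree_link s g (fun v => perspectivity t t' (g v)).
  move=> u v us vs uv /=.
  exact: (perspectivity_edges tt' (gt u us) (gt v vs) (link u v us vs uv)).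
exists (maxn N1 N2) => N; rewrite gtn_max => /andP[NN1 NN2].
by rewrite h1 // h2.
Qed.

End Stages.

Theorem corollary4p23 (R : realType) (d : nat)
    (V : finType) (Gamma : scomplex V) (omega : {perm V}) (sigma : {set V})
    (W : finType) (K : scomplex W) (k : int) :
  Phi_complex Gamma d omega sigma ->
  pure K d ->
  -1 <= k ->
  odd `|k|%N ->
  k_connected R (hom_complex R Gamma K) k ->
  k + d%:Z + 3 <= (chromatic K)%:Z.
Proof.
move=> Phi [[s0 s0K] _] k1 k_odd [[x0 _] pi0].
have [n kE n_even] : exists2 n : nat, k = n%:Z - 1 & ~~ odd n.
  by exists `|(k + 1)%R|%N; lia.
rewrite leNgt; apply/negP => lt_chi.
have [c c_nondeg] : colorable K (chromatic K).
  by rewrite /chromatic; case: ex_minnP => m /asboolP.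
move: (chromatic K) lt_chi c c_nondeg => q lt_q c c_nondeg.
have q_gt0 : (0 < q)%N.
  have /finset.set0Pn[w _] : s0 != finset.set0 by apply: contraNneq (faces_neq0 K) => <-.
  exact: leq_ltn_trans (leq0n _) (ltn_ord (c w)).
have q_le : (q <= n + #|sigma|)%N by rewrite (Phi_sigma_dim Phi); lia.
have oK := Phi_involutive Phi; have oI := Phi_sigma_inv Phi.
have oS := Phi_simplicial Phi; have sG := Phi_sigma_in Phi.
have oN : omega \in ('N(sigma | 'P))%g.
  by apply/astabsP => v; exact: (reindex_mem oI v).
have restrE v : v \in sigma -> restr_perm sigma omega v = omega v.
  by move=> vs; rewrite restr_permE.
have [a aS oa] : exists2 a, a \in sigma & omega a != a.
  apply: contrapT => no; have /eqP := Phi_nontrivial Phi; apply; apply/permP => v.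
  rewrite perm1; case: (boolP (v \in sigma)) => vs; last exact: out_perm (restr_perm_on _ _) vs.
  by rewrite restrE //; apply/eqP/negPn/negP => ov; apply: no; exists v.
have bS : omega a \in sigma by rewrite (reindex_mem oI).
have link : linked Gamma sigma id id.
  by move=> u v us vs uv; split; exact: face_edge sG us vs uv.
pose X := hom_complex R Gamma K.
pose T : X -> X := @precomp R V W Gamma K omega oS.
pose lam := stage_label (G := Gamma) sigma a (omega a) c id : X -> label.
have pos (x : X) : position sigma (stage c id x : V -> 'I_q -> R).
  rewrite -(interpolate0 c id id).
  by apply: (interpolate_position c_nondeg x link); rewrite lexx ler01.
have TE (x : X) v j : color c (T x) v j = color c x (omega v) j by [].
have lam_T (x : X) : lam (T x) = opp_label (lam x).
  by apply: position_label_swap => // v j vs; exact: TE.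
have T_cont : continuous T := @precomp_continuous R V W Gamma K omega oS.
have T_inv : involutive T := precompK oS oK.
have st0 := step_gt0 R V q_gt0.
have eps_gt0 : 0 < step R V q / 2 by rewrite divr_gt0.
have lam_near (x y : X) : (forall i : (V * 'I_q)%type,
    `|color c x i.1 i.2 - color c y i.1 i.2| <= step R V q / 2) ->
    lam x <> opp_label (lam y).
  by move=> xy; apply: position_label_near (pos x) (pos y) _ => v w _; exact: (xy (v, w)).
have lam_axes (x : X) : (lam x).2 \in axes n.
  by apply: position_label_axes q_le _ _.
have pi_n (i : nat) (x : X) : (i < n)%N -> @pi_vanishes R X i x.
  by move=> ni; apply: pi0; lia.
have [e [e_cont e_anti]] := equivariant_sphere T_cont T_inv
  (fun i : (V * 'I_q)%type => @color_continuous R V W Gamma K q c i.1 i.2)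
  (iota_uniq 0 n.+1) lam_axes eps_gt0 lam_near lam_T x0 pi_n.
move=> /(_ e e_cont e_anti (fun _ _ => erefl))[N1 odd_e].
have := Phi_projectivity Phi; rewrite inE => /asboolP[_ [chain [pc _ chainE]]].
have [N2 hE] := stage_degree_path a (omega a) c_nondeg q_gt0 n_even q_le
  e_cont e_anti true (g := id) (fun v vs => vs) (fun u v _ _ uv => uv) pc.
(* On [sigma] the chain realizes [omega], so the transported tuple is that of [T x]. *)
have chain_label (x : X) : stage_label sigma a (omega a) c (transport sigma chain) x = lam (T x).
  apply: eq_position_label => // v j vs; rewrite /stage TE -restrE // chainE //.
set N := (maxn N1 N2).+1.
have {}odd_e := odd_e N (leq_maxl _ _ : (N1 < N)%N).
have := hE N (leq_maxr _ _ : (N2 < N)%N); rewrite /stage_degree.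
have d1 (f : 'rV[R]_n -> X) : degree N (axes n) true n
   (fun p => stage_label sigma a (omega a) c (fun v => transport sigma chain v)
      (f (grid_point R N n p))) =
   degree N (axes n) true n (fun p => opp_label (lam (f (grid_point R N n p)))).
  by apply: eq_degree => p _; rewrite -lam_T -chain_label.
rewrite (d1 e) (d1 (fun x => T (e x))).
have d2 : degree N (axes n) true n (fun p => opp_label (lam (T (e (grid_point R N n p))))) =
   degree N (axes n) true n (fun p => lam (e (grid_point R N n p))).
  by apply: eq_degree => p _; rewrite lam_T opp_labelK.
have d3 : degree N (axes n) true n (fun p => lam (T (e (grid_point R N n p)))) =
   degree N (axes n) true n (fun p => opp_label (lam (e (grid_point R N n p)))).
  by apply: eq_degree => p _; rewrite lam_T.
(* The invariance now reads y - x = x - y, against x + y odd. *)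
rewrite d2 d3 degree_opp; move: odd_e; rewrite /lam /axes /=.
by move: (degree _ _ true _ _) (degree _ _ false _ _) => x y; clear; lia.
Qed.
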